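(* Let $\alpha\in(-\frac{2}{n-1},0]$ (with $-\frac{2}{n-1}:=-\infty$ if $n=1$). Fix integers $n\ge 1$ and $N\ge n+2$, and consider the functional $G_N:\mathcal{C}_\alpha(\mathbb{R}^n)\to[0,\infty)$ defined by $$G_N(f):=\sup_{q\in\mathscr{P}_{\alpha,N}(f)}w_\alpha(q).$$ Then for every $f\in\mathcal{C}_\alpha(\mathbb{R}^n)$ we have $$G_N(f)\ge G_N(f_{\rm sym}^{(\alpha)}).$$
   Context: For $\alpha\in(-\infty,0]$, a function $f:\mathbb{R}^n\to[0,\infty)$ is $\alpha$-concave if $\{f>0\}$ is convex and for all $x,y$ with $f(x),f(y)>0$ and $\lambda\in[0,1]$, $f(\lambda x+(1-\lambda)y)$ is at least $(\lambda f(x)^\alpha+(1-\lambda)f(y)^\alpha)^{1/\alpha}$ if $\alpha<0$, and at least $f(x)^\lambda f(y)^{1-\lambda}$ if $\alpha=0$. $\mathcal{C}_\alpha(\mathbb{R}^n)$ is the set of $\alpha$-concave, upper semicontinuous $f:\mathbb{R}^n\to[0,\infty)$, not identically zero, with $\lim_{|x|\to\infty}f(x)=0$. Base function: $\mathrm{base}_\alpha f:=(1-f^\alpha)/\alpha$ for $\alpha<0$ and $\mathrm{base}_0 f:=-\log f$, with value $+\infty$ where $f=0$. It belongs to $\mathrm{Conv}_{\rm c}(\mathbb{R}^n)$, the set of convex, lower semicontinuous, proper, coercive functions $\mathbb{R}^n\to(-\infty,+\infty]$. With $\psi=\mathrm{base}_\alpha f$ one has $f=(1-\alpha\psi)^{1/\alpha}$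 if $\alpha<0$ and $f=e^{-\psi}$ if $\alpha=0$ (value $0$ where $\psi=+\infty$). $\mathcal{L}\psi(x)=\sup_y(\langle x,y\rangle-\psi(y))$; the $\alpha$-support function of $f$ is $h_f^{(\alpha)}=\mathcal{L}(\mathrm{base}_\alpha f)$. The $\alpha$-mean width is $$w_\alpha(f)=\int_{\mathbb{R}^n}h_f^{(\alpha)}(x)\left(1-\tfrac{\alpha|x|^2}{2}\right)^{\frac{1-\alpha}{\alpha}}dx\ \ (\alpha<0),\qquad w_0(f)=\frac2n\int_{\mathbb{R}^n}h_f^{(0)}(x)\,d\gamma_n(x),$$ where $\gamma_n$ is the standard Gaussian probability measure on $\mathbb{R}^n$. Inner linearizations: for $\psi\in\mathrm{Conv}_{\rm c}(\mathbb{R}^n)$ and a finite nonempty set $\mathbf{X}=\{(x_i,y_i)\}_{i=1}^M$ with $y_i\in\mathbb{R}$, $y_i\ge\psi(x_i)$, the inner linearization $p_{\mathbf{X}}:\mathbb{R}^n\to(-\infty,+\infty]$ is $p_{\mathbf{X}}(x)=\min\{\sum_i\lambda_i y_i:\lambda_i\ge0,\ \sum_i\lambda_i=1,\ \sum_i\lambda_i x_i=x\}$ for $x\in\mathrm{conv}\{x_1,\dots,x_M\}$ and $+\infty$ otherwise. A point $x$ is a break point of $p_{\mathbf{X}}$ if $(x,p_{\mathbf{X}}(x))$ is an extreme point of the epigraph of $p_{\mathbf{X}}$. $\mathscr{C}_N(\psi)$ is the set of all inner linearizations of $\psi$ with at most $N$ break points. For $f\in\mathcal{C}_\alpha(\mathbb{R}^n)$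 with $\psi=\mathrm{base}_\alpha f$, $\mathscr{P}_{\alpha,N}(f)=\{(1-\alpha p)^{1/\alpha}:p\in\mathscr{C}_N(\psi)\}$ if $\alpha<0$ and $\mathscr{P}_{0,N}(f)=\{e^{-p}:p\in\mathscr{C}_N(\psi)\}$. Reflectional hypo-symmetrization: for $\psi\in\mathrm{Conv}_{\rm c}(\mathbb{R}^n)$, $\psi_{\rm sym}$ is the unique radial (i.e. $\mathrm{O}(n)$-invariant) function in $\mathrm{Conv}_{\rm c}(\mathbb{R}^n)$ with $\mathcal{L}\psi_{\rm sym}(x)=\int_{\mathrm{O}(n)}\mathcal{L}\psi(\vartheta^{-1}x)\,d\eta(\vartheta)$ for all $x$, $\eta$ being the Haar probability measure on $\mathrm{O}(n)$. For $f\in\mathcal{C}_\alpha(\mathbb{R}^n)$ with $\psi=\mathrm{base}_\alpha f$, $f_{\rm sym}^{(\alpha)}=(1-\alpha\psi_{\rm sym})^{1/\alpha}$ if $\alpha<0$ and $f_{\rm sym}^{(0)}=e^{-\psi_{\rm sym}}$; it belongs to $\mathcal{C}_\alpha(\mathbb{R}^n)$.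
   Formalization: G_N is taken with values in [-∞,+∞] instead of [0,∞), and the inequality is read there for every f: for α=0, G_N is negative for f=c·1_{0} with 0<c<1 and is +∞ for f=exp(-|x|). *)

(* Defs.v *)
From HB Require Import structures.
From mathcomp Require Import all_boot all_order all_algebra.
From mathcomp Require Import all_classical all_reals all_analysis.
Set Implicit Arguments.
Unset Strict Implicit.
Unset Printing Implicit Defensive.
Import Order.TTheory GRing.Theory Num.Theory.
Import numFieldNormedType.Exports.
Local Open Scope classical_set_scope.
Local Open Scope ring_scope.

(* The n-fold product of a sigma-finite measure, as a measure on n-tuples:
   the library only has binary products of measures. *)
Section PowerMeasure.
Context {d : measure_display} {T : measurableType d} {R : realType}.

Definition cons_pair n (x : T * n.-tuple T) : n.+1.-tuple T :=
  [tuple of x.1 :: x.2].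

Definition uncons_pair n (t : n.+1.-tuple T) : T * n.-tuple T :=
  (thead t, [tuple of behead t]).

Lemma measurable_cons_pair n : measurable_fun setT (@cons_pair n).
Proof. exact: measurable_cons. Qed.

Lemma measurable_uncons_pair n : measurable_fun setT (@uncons_pair n).
Proof.
apply: measurable_fun_pair; [exact: measurable_tnth|exact: measurable_behead].
Qed.

Lemma cons_pairK n : cancel (@cons_pair n) (@uncons_pair n).
Proof.
by case=> x t; rewrite /uncons_pair theadE; congr (_, _); exact/val_inj.
Qed.

Section Cons.
Variables (n : nat) (m1 : {sigma_finite_measure set T -> \bar R}).
Variable m2 : {sigma_finite_measure set (n.-tuple T) -> \bar R}.

Definition cons_measure : set (n.+1.-tuple T) -> \bar R :=
  pushforward (m1 \x m2)%E (@cons_pair n).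

Let cons_measure0 : cons_measure set0 = 0%E.
Proof. by rewrite /cons_measure /pushforward preimage_set0 measure0. Qed.

Let cons_measure_ge0 A : (0 <= cons_measure A)%E.
Proof. by rewrite /cons_measure /pushforward measure_ge0. Qed.

Let measurable_preimage_cons A :
  measurable A -> measurable (@cons_pair n @^-1` A).
Proof.
by move=> mA; rewrite -[X in measurable X]setTI; exact: measurable_cons_pair.
Qed.

Let cons_measure_sigma_additive : semi_sigma_additive cons_measure.
Proof.
move=> F mF tF mUF; rewrite /cons_measure /pushforward preimage_bigcup.
apply: measure_semi_sigma_additive.
- by move=> i; exact: measurable_preimage_cons.
- apply/trivIsetP => /= i j _ _ ij; rewrite -preimage_setI.
  by move/trivIsetP : tF => /(_ _ _ _ _ ij) ->//; rewrite preimage_set0.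
- by rewrite -preimage_bigcup; exact: measurable_preimage_cons.
Qed.

HB.instance Definition _ := isMeasure.Build _ _ _ cons_measure
  cons_measure0 cons_measure_ge0 cons_measure_sigma_additive.

Let cons_measure_sigma_finite : sigma_finite setT cons_measure.
Proof.
have /sigma_finiteP[F [FT ndF Foo]] := sigma_finiteT m1.
have /sigma_finiteP[G [GT ndG Goo]] := sigma_finiteT m2.
exists (fun k => @uncons_pair n @^-1` (F k `*` G k)).
  rewrite -preimage_bigcup (_ : \bigcup_k _ = setT) ?preimage_setT//.
  apply/seteqP; split=> // -[x t] _.
  have [i _ Fx] : (\bigcup_i F i) x by rewrite -FT.
  have [j _ Gt] : (\bigcup_i G i) t by rewrite -GT.
  exists (maxn i j) => //; split => /=.
    by move: x Fx; exact/subsetPset/ndF/leq_maxl.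
  by move: t Gt; exact/subsetPset/ndG/leq_maxr.
move=> k; have [mF Fk] := Foo k; have [mG Gk] := Goo k; split.
  rewrite -[X in measurable X]setTI; apply: measurable_uncons_pair => //.
  exact: measurableX.
rewrite /cons_measure /pushforward -comp_preimage.
rewrite (_ : _ \o _ = id); last by apply/funext => x /=; rewrite cons_pairK.
rewrite preimage_id.
by rewrite product_measure1E// lte_mul_pinfty// ge0_fin_numE.
Qed.

HB.instance Definition _ := Measure_isSigmaFinite.Build _ _ _ cons_measure
  cons_measure_sigma_finite.

End Cons.

Fixpoint power_measure (m : {sigma_finite_measure set T -> \bar R}) n :
    {sigma_finite_measure set (n.-tuple T) -> \bar R} :=
  match n with
  | 0 => \d_([tuple] : 0.-tuple T)
  | n'.+1 => cons_measure m (power_measure m n')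
  end.

End PowerMeasure.

(* Points of R^n are the column vectors ['cV[R]_n].  The library norm on
   matrices is the sup norm; [enorm] is Euclidean and gives the same topology. *)
Section Euclidean.
Context {R : realType} {n : nat}.
Local Notation vec := 'cV[R]_n.

Definition inner (x y : vec) : R := \sum_i x i 0 * y i 0.
Definition enorm (x : vec) : R := Num.sqrt (inner x x).

Definition vec_of_tuple (t : n.-tuple R) : vec := \col_i tnth t i.

Definition vec_lebesgue :
    {sigma_finite_measure set (n.-tuple (measurableTypeR R)) -> \bar R} :=
  power_measure (@lebesgue_measure R) n.

Definition vec_gauss :
    {sigma_finite_measure set (n.-tuple (measurableTypeR R)) -> \bar R} :=
  power_measure (@normal_prob R 0 1) n.

Definition orthogonal_group : set 'M[R]_n := [set Q | Q^T *m Q = 1%:M].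

(* The Haar probability measure of O(n), seen as a Borel probability measure
   on square matrices concentrated on O(n). *)
Definition is_haar
    (eta : probability (g_sigma_algebraType (@open 'M[R]_n)) R) : Prop :=
  eta orthogonal_group = 1%E /\
  forall Q (A : set (g_sigma_algebraType (@open 'M[R]_n))),
    orthogonal_group Q -> measurable A ->
    eta ((fun P : 'M[R]_n => Q *m P) @^-1` A) = eta A.

End Euclidean.
Arguments vec_lebesgue {R} n.
Arguments vec_gauss {R} n.

Section ConvexFunctions.
Context {R : realType} {n : nat}.
Local Notation vec := 'cV[R]_n.
Implicit Types psi phi p : vec -> \bar R.

Definition Conv_c : set (vec -> \bar R) := [set psi : vec -> \bar R |
  [/\ (forall x, -oo < psi x)%E,
      (exists x, psi x < +oo)%E,
      (forall x y (t : R), 0 <= t <= 1 ->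
        (psi (t *: x + (1 - t) *: y)%R <= t%:E * psi x + (1 - t)%:E * psi y)%E),
      lower_semicontinuous psi &
      (forall A : R, exists r : R, forall x, r <= enorm x ->
        (A%:E <= psi x)%E)]].

Definition legendre psi (x : vec) : \bar R :=
  ereal_sup [set ((inner x y)%:E - psi y)%E | y in setT].

Definition radial psi : Prop :=
  forall Q x, orthogonal_group Q -> psi (Q *m x) = psi x.

(* [phi] is psi_sym: since functions in [Conv_c] are determined by their
   Legendre transform, there is at most one such [phi]. *)
Definition is_hypo_sym
    (eta : probability (g_sigma_algebraType (@open 'M[R]_n)) R)
    psi phi : Prop :=
  [/\ Conv_c phi, radial phi &
      forall x, legendre phi x =
        (\int[eta]_(Q in orthogonal_group) legendre psi (invmx Q *m x))%E].

(* The infimum of the empty set is +oo, which is the value outside the convex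
   hull of the points [xs i]; inside it, the infimum is a minimum since the
   set of admissible coefficients is compact. *)
Definition inner_linearization M (xs : 'I_M -> vec) (ys : 'I_M -> R)
    (x : vec) : \bar R :=
  ereal_inf [set (\sum_i lam i * ys i)%:E | lam in [set lam : 'I_M -> R |
    [/\ forall i, 0 <= lam i, \sum_i lam i = 1 & \sum_i lam i *: xs i = x]]].

Definition extreme_point (E : lmodType R) (A : set E) (z : E) : Prop :=
  A z /\ forall u v t, A u -> A v -> 0 < t < 1 ->
    z = t *: u + (1 - t) *: v -> u = z /\ v = z.

Definition epigraph psi : set (vec * R^o) := [set z | (psi z.1 <= z.2%:E)%E].

Definition break_points psi : set vec :=
  [set x | exists r : R, psi x = r%:E /\ extreme_point (epigraph psi) (x, r)].

Definition inner_linearizations N psi : set (vec -> \bar R) :=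
  [set p : vec -> \bar R |
  (exists M (xs : 'I_M -> vec) (ys : 'I_M -> R),
    [/\ (0 < M)%N, forall i, (psi (xs i) <= (ys i)%:E)%E &
        p = inner_linearization xs ys]) /\
  (break_points p #<= `I_N)%card].

End ConvexFunctions.

Section AlphaConcave.
Context {R : realType} {n : nat} (alpha : R).
Local Notation vec := 'cV[R]_n.
Implicit Type f : vec -> R.

Definition alpha_mean (t a b : R) : R :=
  if alpha == 0 then a `^ t * b `^ (1 - t)
  else (t * a `^ alpha + (1 - t) * b `^ alpha) `^ alpha^-1.

Definition alpha_concave f : Prop :=
  convex_set ([set x | 0 < f x] : set (convex_lmodType vec)) /\
  forall x y t, 0 < f x -> 0 < f y -> 0 <= t <= 1 ->
    alpha_mean t (f x) (f y) <= f (t *: x + (1 - t) *: y).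

(* Upper semicontinuity of [f] is lower semicontinuity of [- f]. *)
Definition C_alpha : set (vec -> R) := [set f : vec -> R |
  [/\ (forall x, 0 <= f x) /\ alpha_concave f,
      lower_semicontinuous (fun x => (- f x)%:E),
      (exists x, f x != 0) &
      forall e : R, 0 < e -> exists r : R, forall x, r <= enorm x -> f x < e]].

Definition base f (x : vec) : \bar R :=
  if f x == 0 then +oo%E
  else if alpha == 0 then (- ln (f x))%:E
  else ((1 - f x `^ alpha) / alpha)%:E.

(* The inverse of [base]; the value at -oo is irrelevant, as functions in
   [Conv_c] and inner linearizations never take it. *)
Definition unbase (psi : vec -> \bar R) (x : vec) : R :=
  if psi x is r%:E then
    if alpha == 0 then expR (- r) else (1 - alpha * r) `^ alpha^-1
  else 0.

Definition support_fun f : vec -> \bar R := legendre (base f).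

Definition mean_width f : \bar R :=
  if alpha == 0 then
    ((2 / n%:R)%:E *
      \int[vec_gauss n]_t support_fun f (vec_of_tuple t))%E
  else
    (\int[vec_lebesgue n]_t
      (support_fun f (vec_of_tuple t) *
       ((1 - alpha * enorm (vec_of_tuple t) ^+ 2 / 2)
          `^ ((1 - alpha) / alpha))%:E))%E.

Definition P_alpha N f : set (vec -> R) :=
  [set unbase p | p in inner_linearizations N (base f)].

(* Extended-real valued: the supremum is +oo for f = exp(-|x|), alpha = 0, and
   it can be negative when f < 1. *)
Definition G_alpha N f : \bar R :=
  ereal_sup [set mean_width q | q in P_alpha N f].

End AlphaConcave.

(* Main.v *)
Require Import Defs.
From HB Require Import structures.
From mathcomp Require Import all_boot all_order all_algebra.
From mathcomp Require Import all_classical all_reals all_analysis.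
From mathcomp Require Import measurable_realfun.
From mathcomp Require Import ring lra.
Set Implicit Arguments.
Unset Strict Implicit.
Unset Printing Implicit Defensive.
Import Order.TTheory GRing.Theory Num.Theory.
Import numFieldNormedType.Exports.
Local Open Scope classical_set_scope.
Local Open Scope ring_scope.

(** Let [F(z, t)] be the weighted integral of [max_i (<x, z_i> - t_i)], so that
    the mean width of an inner linearization [p] of [psi_sym] with data
    [(x_i, y_i)] is [F(x, y)].  [F] is convex, and a subgradient at [(x, y)] is
    given by the mass [b_i] and the first moment [b_i c_i] of the cells where
    the i-th affine function is maximal:
      [F(z, t) >= sum_i b_i (<c_i, z_i> - t_i)], with equality at [(x, y)].
    By Fenchel's inequality and the definition of [psi_sym],
      [F(x, y) <= sum_i b_i (L psi_sym)(c_i)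
                = int_{O(n)} sum_i b_i (L psi)(Q^T c_i)],
    so some [Q], together with points [(z_i, t_i)] of the epigraph of [psi],
    satisfies [sum_i b_i (<Q^T c_i, z_i> - t_i) > F(x, y) - e].  The left-hand
    side is at most [F(Q z, t)], which is [F(z, t)] because the weight is
    rotation invariant.  No measurable selection is needed. *)

(** * Maxima of affine functions and inner linearizations *)

(** Rotating and replacing data points preserves their number, whereas the admissible linearizations
    are limited by their break points. So the bound [N] is first transferred: a linearization with
    at most [N] break points has the Legendre transform of some data with at most [N] points, and
    conversely at most [N] points produce at most [N] break points.

    The Legendre transform of [psi] may be infinite, as coercivity does not force superlinear
    growth. The choice of the rotation is therefore argued by contradiction: if no choice exceeds
    the level [S], the transforms with [b_i > 0] are bounded on O(n), and integrals and suprema can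
    be handled safely.

    The lower bound on [alpha] says that [|x| w(x)] is integrable: this function decays like [|x|]
    to the power [2 / alpha - 1], which is below [- n] exactly when [alpha > - 2 / (n - 1)] (for
    [n > 1]). Polar coordinates and Jacobians are avoided: integrability comes from domination by a
    product of functions of one coordinate, rotation invariance from Tonelli's theorem against a
    radial Gaussian density. *)

Section InnerProduct.
Context {R : realType} {n : nat}.
Implicit Types (x y z : 'cV[R]_n) (Q : 'M[R]_n).

Lemma innerC x y : inner x y = inner y x.
Proof. by apply: eq_bigr => i _; rewrite mulrC. Qed.

Lemma innerDl x y z : inner (x + y) z = inner x z + inner y z.
Proof.
by rewrite /inner -big_split; apply: eq_bigr => i _; rewrite mxE mulrDl.
Qed.

Lemma innerZl a x y : inner (a *: x) y = a * inner x y.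
Proof. by rewrite /inner mulr_sumr; apply: eq_bigr => i _; rewrite mxE mulrA. Qed.

Lemma innerDr x y z : inner z (x + y) = inner z x + inner z y.
Proof. by rewrite innerC innerDl !(innerC z). Qed.

Lemma innerZr a x y : inner y (a *: x) = a * inner y x.
Proof. by rewrite innerC innerZl innerC. Qed.

Lemma innerBr x y z : inner z (x - y) = inner z x - inner z y.
Proof. by rewrite innerDr -scaleN1r innerZr mulN1r. Qed.

Lemma inner0r x : inner x 0 = 0.
Proof. by rewrite -(scale0r x) innerZr mul0r. Qed.

Lemma inner_sumr (I : finType) (F : I -> 'cV[R]_n) x :
  inner x (\sum_i F i) = \sum_i inner x (F i).
Proof.
by apply: (big_morph (inner x)) => [y z|]; rewrite ?innerDr ?inner0r.
Qed.

Lemma inner_ge0 x : 0 <= inner x x.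
Proof. by apply: sumr_ge0 => i _; rewrite -expr2 sqr_ge0. Qed.

Lemma inner_eq0 x : inner x x <= 0 -> x = 0.
Proof.
move=> x0; apply/matrixP => i j; rewrite ord1 mxE; apply/eqP.
have /eqP : inner x x = 0 by apply/eqP; rewrite eq_le x0 inner_ge0.
rewrite psumr_eq0 => [/allP/(_ i)|k _]; last by rewrite -expr2 sqr_ge0.
by rewrite mem_index_enum => /(_ isT)/=; rewrite mulf_eq0 orbb.
Qed.

Lemma inner_mulmx_tr Q x y : inner (Q *m x) y = inner x (Q^T *m y).
Proof.
have innerE (u v : 'cV[R]_n) : inner u v = (u^T *m v) 0 0.
  by rewrite mxE; apply: eq_bigr => i _; rewrite mxE.
by rewrite !innerE trmx_mul mulmxA.
Qed.

Lemma inner_orthogonal Q x y : orthogonal_group Q ->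
  inner (Q *m x) (Q *m y) = inner x y.
Proof. by move=> oQ; rewrite inner_mulmx_tr mulmxA oQ mul1mx. Qed.

Lemma orthogonal_tr Q : orthogonal_group Q -> orthogonal_group Q^T.
Proof. by move=> /mulmx1C oQ; rewrite /orthogonal_group/= trmxK. Qed.

Lemma invmx_orthogonal Q : orthogonal_group Q -> invmx Q = Q^T.
Proof.
move=> oQ; have [_ uQ] := mulmx1_unit oQ.
by rewrite -[RHS]mulmx1 -(mulmxV uQ) mulmxA oQ mul1mx.
Qed.

End InnerProduct.

Section MaxAffine.
Context {R : realType} {n : nat}.
Local Notation vec := 'cV[R]_n.

Definition aff M (xs : 'I_M -> vec) (ys : 'I_M -> R) i (x : vec) : R :=
  inner x (xs i) - ys i.

Definition max_aff M (xs : 'I_M.+1 -> vec) (ys : 'I_M.+1 -> R) (x : vec) : R :=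
  \big[Order.max/aff xs ys ord0 x]_i aff xs ys i x.

Lemma aff_le_max M (xs : 'I_M.+1 -> vec) ys i x :
  aff xs ys i x <= max_aff xs ys x.
Proof. exact: le_bigmax. Qed.

Lemma max_aff_attained M (xs : 'I_M.+1 -> vec) ys x :
  exists i, max_aff xs ys x = aff xs ys i x.
Proof.
rewrite /max_aff; elim/big_ind : _ => [|_ _ [i ->] [j ->]|i _].
    by exists ord0.
  by case: (leP (aff xs ys i x) (aff xs ys j x)) => _; [exists j|exists i].
by exists i.
Qed.

(** Weak duality: admissible coefficients average the inequalities
    [aff xs ys i x <= max_aff xs ys x]. In particular the value [-oo] is excluded. *)
Lemma inner_linearization_ge M (xs : 'I_M.+1 -> vec) ys x z :
  ((inner x z - max_aff xs ys x)%:E <= inner_linearization xs ys z)%E.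
Proof.
apply: le_ereal_inf_tmp => _ [lam [lam0 lam1 <-] <-]; rewrite lee_fin.
rewrite inner_sumr -[X in _ - X]mul1r -lam1 mulr_suml -sumrB ler_sum // => i _.
rewrite innerZr -mulrBr ler_wpM2l// lerBlDr -lerBlDl.
exact: aff_le_max.
Qed.

Lemma inner_linearization_le M (xs : 'I_M -> vec) ys i :
  (inner_linearization xs ys (xs i) <= (ys i)%:E)%E.
Proof.
apply: ereal_inf_lbound; exists (fun j => (j == i)%:R); last first.
  by rewrite (bigD1 i)//= eqxx mul1r big1 ?addr0// => j /negPf->; rewrite mul0r.
split=> [j||]; first exact: ler0n.
  by rewrite (bigD1 i)//= eqxx big1 ?addr0// => j /negPf->.
by rewrite (bigD1 i)//= eqxx scale1r big1 ?addr0// => j /negPf->; rewrite scale0r.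
Qed.

Lemma legendre_inner_linearization M (xs : 'I_M.+1 -> vec) ys x :
  legendre (inner_linearization xs ys) x = (max_aff xs ys x)%:E.
Proof.
apply/eqP; rewrite eq_le; apply/andP; split.
  apply: ge_ereal_sup => _ [z _ <-].
  have := inner_linearization_ge xs ys x z.
  case: inner_linearization => [r| |]//=; last by rewrite leNye.
  by rewrite -EFinB !lee_fin lerBlDr lerBlDl.
have [i ->] := max_aff_attained xs ys x.
apply: le_trans (ereal_sup_ubound _); last by exists (xs i).
by rewrite /aff EFinB leeB// inner_linearization_le.
Qed.

Lemma epigraph_aff_le M (xs : 'I_M.+1 -> vec) ys x z :
  epigraph (inner_linearization xs ys) z ->
  inner x z.1 - z.2 <= max_aff xs ys x.
Proof.
move=> /(le_trans (inner_linearization_ge xs ys x z.1)).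
by rewrite lee_fin lerBlDr lerBlDl.
Qed.

Definition dominating M (xs : 'I_M -> vec) ys (I : {set 'I_M}) : Prop :=
  forall x j, exists2 i, i \in I & aff xs ys j x <= aff xs ys i x.

(** Take a dominating set that is minimal for inclusion: if some [i] were nowhere strictly above the
    rest of [I], then [I :\ i] would still dominate. *)
Lemma minimal_dominating M (xs : 'I_M -> vec) ys :
  exists2 I : {set 'I_M}, dominating xs ys I &
    forall i, i \in I -> exists x, forall k, k \in I -> k != i ->
      aff xs ys k x < aff xs ys i x.
Proof.
pose P (I : {set 'I_M}) := `[< dominating xs ys I >].
have PT : P [set: 'I_M]%SET by apply/asboolP => x j; exists j; rewrite ?inE.
have [I /minsetP[/asboolP dI minI] _] := minset_exists PT.
exists I => // i iI; apply: contrapT => noxi.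
have /minI/(_ (subD1set _ _))/setP/(_ i) : P (I :\ i).
  apply/asboolP => x j; apply: contrapT => nok.
  apply: noxi; exists x => k kI ki.
  have [i' i'I ji'] := dI x j.
  have [i'i|i'i] := eqVneq i' i; last first.
    by exfalso; apply: nok; exists i'; rewrite ?inE ?i'i.
  subst i'; rewrite (lt_le_trans _ ji')// ltNge; apply/negP => jk.
  by apply: nok; exists k; rewrite ?inE ?ki.
by rewrite !inE eqxx iI.
Qed.

Lemma dominating_max M (xs : 'I_M.+1 -> vec) ys (I : {set 'I_M.+1}) x i :
  dominating xs ys I -> i \in I ->
  (forall k, k \in I -> k != i -> aff xs ys k x <= aff xs ys i x) ->
  max_aff xs ys x = aff xs ys i x.
Proof.
move=> dI iI maxi; apply/eqP; rewrite eq_le aff_le_max andbT.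
have [j ->] := max_aff_attained xs ys x; have [k kI jk] := dI x j.
by apply: le_trans jk _; have [->//|] := eqVneq k i; exact: maxi.
Qed.

Section Exposed.
Variables (M : nat) (xs : 'I_M.+1 -> vec) (ys : 'I_M.+1 -> R).
Variables (I : {set 'I_M.+1}) (i : 'I_M.+1) (x : vec).
Hypotheses (dI : dominating xs ys I) (iI : i \in I).
Hypothesis ltx : forall k, k \in I -> k != i -> aff xs ys k x < aff xs ys i x.

(** Since [aff i] is maximal at [x], the weak duality bound with slope [x] at the point [xs i] is
    exactly [ys i]. *)
Lemma exposed_value : inner_linearization xs ys (xs i) = (ys i)%:E.
Proof.
apply/eqP; rewrite eq_le inner_linearization_le/=.
apply: le_trans (inner_linearization_ge xs ys x (xs i)).
rewrite lee_fin (dominating_max dI iI) => [|k kI ki]; last exact/ltW/ltx.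
by rewrite /aff opprB addrC subrK.
Qed.

(* The inequality [inner x' z - r <= max_aff x'] is an equality at [x], and
   around [x] the right-hand side is [aff i]: the gradients agree. *)
Lemma exposed_unique z :
  epigraph (inner_linearization xs ys) z ->
  aff xs ys i x <= inner x z.1 - z.2 -> z = (xs i, ys i).
Proof.
move=> ez xz; pose d := z.1 - xs i.
pose e k := inner d (xs k - xs i); pose g k := aff xs ys i x - aff xs ys k x.
(* Small enough that [s * e k <= g k] for all other [k] in [I], so that [aff i] is still maximal at
   [x + s *: d]; the [1 +] keeps [s] positive when the sum vanishes. *)
pose s := (1 + \sum_(k in I | k != i) `|e k| / g k)^-1.
have g0 k : k \in I -> k != i -> 0 < g k by move=> kI ki; rewrite subr_gt0 ltx.
have sum0 : 0 <= \sum_(k in I | k != i) `|e k| / g k.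
  by apply: sumr_ge0 => k /andP[kI ki]; rewrite divr_ge0// ltW// g0.
have s0 : 0 < s by rewrite invr_gt0 ltr_pwDl.
have affD k : aff xs ys k (x + s *: d) = aff xs ys k x + s * inner d (xs k).
  by rewrite /aff innerDl innerZl addrAC.
have maxE : max_aff xs ys (x + s *: d) = aff xs ys i (x + s *: d).
  apply: dominating_max dI iI _ => k kI ki.
  rewrite !affD.
  have : s * e k <= g k.
    have gk := g0 k kI ki.
    rewrite (le_trans (ler_wpM2l (ltW s0) (ler_norm _)))//.
    rewrite /s mulrC ler_pdivrMr ?ltr_pwDl// mulrC -ler_pdivrMr//.
    rewrite ler_wpDl// (bigD1 k) ?kI//= lerDl.
    by apply: sumr_ge0 => l /andP[/andP[lI li] _]; rewrite divr_ge0// ltW// g0.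
  by rewrite /e /g innerBr; lra.
(* Combined with the assumed inequality at [x], this leaves [s * inner d d <= 0]. *)
have := epigraph_aff_le (x + s *: d) ez.
rewrite maxE affD innerDl innerZl => le1.
have d0 : d = 0.
  apply: inner_eq0; rewrite -(pmulr_rle0 _ s0) {2}/d innerBr.
  by move: le1 xz; lra.
have z1 : z.1 = xs i by apply/eqP; rewrite -subr_eq0 -/d d0.
move: le1 xz; rewrite z1 d0 /aff (innerC 0) inner0r => le1 xz.
move: ez; rewrite /epigraph/= z1 exposed_value lee_fin => yz.
rewrite [z]surjective_pairing z1; congr (_, _); apply/le_anti.
by rewrite yz andbT; move: xz; lra.
Qed.

(** An exposed point is extreme: on the epigraph, [inner x z.1 - z.2] is largest only at
    [(xs i, ys i)], and a proper convex combination reaches the maximum only if both ends do. *)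
Lemma exposed_break_point : break_points (inner_linearization xs ys) (xs i).
Proof.
exists (ys i); split; first exact: exposed_value.
split=> [|u v t eu ev /andP[t0 t1] uv].
  by rewrite /epigraph/= exposed_value.
have maxE : max_aff xs ys x = aff xs ys i x.
  by apply: dominating_max dI iI _ => k kI ki; exact/ltW/ltx.
have := epigraph_aff_le x eu; have := epigraph_aff_le x ev; rewrite maxE.
have : aff xs ys i x =
    t * (inner x u.1 - u.2) + (1 - t) * (inner x v.1 - v.2).
  have [xE yE] : xs i = t *: u.1 + (1 - t) *: v.1 /\ ys i = t * u.2 + (1 - t) * v.2.
    by move: uv => -[].
  by rewrite /aff xE yE innerDr !innerZr; ring.
set a := aff xs ys i x; set b := _ - u.2; set c := _ - v.2 => abc ca ba.
have t10 : 0 < 1 - t by rewrite subr_gt0.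
have ab : a <= b by rewrite -subr_le0 -(pmulr_rle0 _ t0); nra.
have ac : a <= c by rewrite -subr_le0 -(pmulr_rle0 _ t10); nra.
by split; exact: exposed_unique.
Qed.

End Exposed.

Lemma break_points_inner_linearization M (xs : 'I_M.+1 -> vec) ys :
  break_points (inner_linearization xs ys) `<=` range xs.
Proof.
move=> x [r [px [exr extr]]].
(* Below [1 / (M + 1)], so [M.+1] coefficients of sum 1 cannot all be smaller than [c]; and below 1
   even when [M = 0]. *)
pose c : R := M.+2%:R^-1.
have c0 : 0 < c by rewrite invr_gt0 ltr0n.
have c1 : c < 1 by rewrite invf_lt1 ?ltr1n ?ltr0n.
have c10 : 0 < 1 - c by rewrite subr_gt0.
(* [(x, r)] is a convex combination of [(xs i, ys i)] and [(w i, s i)].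
   Nearly optimal coefficients [lam] at [x] have some [c <= lam i], which forces
   [(w i, s i)] into the epigraph; the infimum need not be attained. *)
pose w i := (1 - c)^-1 *: (x - c *: xs i).
pose s i := (1 - c)^-1 * (r - c * ys i).
have wK i : x = c *: xs i + (1 - c) *: w i.
  by rewrite scalerA divff ?gt_eqF// scale1r addrC subrK.
have sK i : r = c * ys i + (1 - c) * s i.
  by rewrite mulrA divff ?gt_eqF// mul1r addrC subrK.
have [[i wsi]|no] :=
    pselect (exists i, inner_linearization xs ys (w i) <= (s i)%:E)%E.
  exists i => //.
  have xrE : (x, r) = c *: (xs i, ys i : R^o) + (1 - c) *: (w i, s i : R^o).
    by congr (_, _); [exact: wK|exact: sK].
  have c01 : 0 < c < 1 by rewrite c0 c1.
  by have [[->]] := extr (xs i, ys i) (w i, s i) _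
    (inner_linearization_le xs ys i) wsi c01 xrE.
have gap i : exists2 d, 0 < d &
    ((s i + d)%:E <= inner_linearization xs ys (w i))%E.
  have : ((s i)%:E < inner_linearization xs ys (w i))%E.
    by rewrite ltNge; apply/negP => wsi; apply: no; exists i.
  case: inner_linearization => [v| |]//=.
    rewrite lte_fin => sv; exists (v - s i); first by rewrite subr_gt0.
    by rewrite addrC subrK.
  by move=> _; exists 1 => //; rewrite leey.
have {gap}[d d0 dP] : exists2 d : 'I_M.+1 -> R, (forall i, 0 < d i) &
    forall i, ((s i + d i)%:E <= inner_linearization xs ys (w i))%E.
  have /choice[d dP] i : exists d, 0 < d /\
      ((s i + d)%:E <= inner_linearization xs ys (w i))%E.
    by have [d d0 dP] := gap i; exists d.
  by exists d => i; have [] := dP i.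
(* A positive number below every gap [d i]: the slack allowed to nearly optimal coefficients. *)
pose e := (\sum_i (d i)^-1)^-1.
have sum0 : 0 < \sum_i (d i)^-1.
  rewrite (bigD1 ord0)//= ltr_pwDl ?invr_gt0// sumr_ge0// => i _.
  by rewrite invr_ge0 ltW.
have e0 : 0 < e by rewrite invr_gt0.
have ed i : e <= d i.
  rewrite /e -[leRHS]invrK lef_pV2 ?posrE ?invr_gt0// (bigD1 i)//= lerDl.
  by apply: sumr_ge0 => j _; rewrite invr_ge0 ltW.
have /ereal_inf_lt[_ [lam [lam0 lam1 lamx] <-]] :
    (inner_linearization xs ys x < (r + (1 - c) * e)%:E)%E.
  by rewrite px lte_fin ltrDl mulr_gt0.
rewrite lte_fin => lamr.
have [i lami] : exists i, c <= lam i.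
  apply: contrapT => nolam.
  have : \sum_i lam i <= \sum_(i < M.+1) c.
    apply: ler_sum => i _; rewrite leNgt; apply/negP => /ltW ?.
    by apply: nolam; exists i.
  rewrite lam1 sumr_const card_ord -mulr_natl leNgt ltr_pdivrMr ?ltr0n//.
  by rewrite mul1r ltr_nat ltnSn.
(* Taking [c] away from [lam i] and renormalizing gives admissible coefficients at [w i]. Their
   value is below [s i + e <= s i + d i], against the choice of [d i]. *)
have /(le_trans (dP i)) : (inner_linearization xs ys (w i) <=
    ((1 - c)^-1 * (\sum_j lam j * ys j - c * ys i))%:E)%E.
  apply: ereal_inf_lbound.
  exists (fun j => (1 - c)^-1 * (lam j - (j == i)%:R * c)); last first.
    congr EFin; under eq_bigr do rewrite -mulrA mulrBl.
    rewrite -mulr_sumr sumrB; congr (_ * (_ - _)).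
    rewrite (bigD1 i)//= eqxx mul1r big1 ?addr0// => j /negPf->.
    by rewrite !mul0r.
  split=> [j||].
  - rewrite mulr_ge0 ?invr_ge0 ?(ltW c10)// subr_ge0.
    by have [->|_] := eqVneq j i; rewrite ?mul1r// mul0r.
  - rewrite -mulr_sumr sumrB lam1 (bigD1 i)//= eqxx mul1r big1 ?addr0.
      by rewrite mulVf// gt_eqF.
    by move=> j /negPf->; rewrite mul0r.
  - under eq_bigr do rewrite -scalerA scalerBl.
    rewrite -scaler_sumr sumrB lamx; congr (_ *: (_ - _)).
    rewrite (bigD1 i)//= eqxx mul1r big1 ?addr0// => j /negPf->.
    by rewrite mul0r scale0r.
rewrite lee_fin /s => le1; exfalso.
have := ed i; move: le1; rewrite -lerBrDl -mulrBr leNgt => /negP nlt ei.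
apply: nlt; rewrite (lt_le_trans _ ei)// ltr_pdivrMl//; lra.
Qed.

End MaxAffine.

(** * Number of break points and number of data points *)

Section Reduction.
Context {R : realType} {n : nat}.
Local Notation vec := 'cV[R]_n.
Implicit Types psi p : vec -> \bar R.

(** Keep the data indexed by a minimal dominating set: the maximum of the affine functions does not
    change, and each remaining point is a break point of [p], so at most [N] remain. *)
Lemma inner_linearizations_support N psi p : inner_linearizations N psi p ->
  exists m (xs : 'I_m.+1 -> vec) ys, [/\ (m < N)%N,
    forall i, (psi (xs i) <= (ys i)%:E)%E &
    forall x, legendre p x = (max_aff xs ys x)%:E].
Proof.
move=> [[M [xs [ys [M0 psi_le pE]]]] breakN].
case: M M0 xs ys psi_le pE => // M _ xs ys psi_le pE.
have [I dI strictI] := minimal_dominating xs ys.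
have I0 : (0 < #|I|)%N.
  by have [i iI _] := dI 0 ord0; rewrite card_gt0; apply/set0Pn; exists i.
(* Two indices of [I] at the same point have the same [ys] by [exposed_value], hence the same affine
   function, and neither could be strictly above the other. *)
have inj_xs : injective (xs \o @enum_val _ (mem I)).
  move=> i j /= xij; apply: contrapT => /eqP ij.
  have iI := enum_valP i; have jI := enum_valP j.
  have [x ltx] := strictI _ iI; have [y lty] := strictI _ jI.
  have := exposed_value dI iI ltx; have := exposed_value dI jI lty.
  rewrite xij => -> [yij]; have := ltx _ jI; rewrite (inj_eq enum_val_inj).
  by rewrite eq_sym ij /aff xij yij ltxx => /(_ isT).
have IN : (#|I| <= N)%N.
  rewrite -card_le_II; apply: (card_le_trans _ breakN).
  rewrite (card_le_eql card_II) -(card_le_eql (inj_card_eq (in2W inj_xs))).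
  apply: subset_card_le => _ [i _ <-]; have iI := enum_valP i.
  have [x ltx] := strictI _ iI.
  by rewrite pE; exact: (exposed_break_point dI iI ltx).
have mI : #|I| = #|I|.-1.+1 by rewrite prednK.
pose e (k : 'I_(#|I|.-1.+1)) := @enum_val _ (mem I) (cast_ord (esym mI) k).
exists #|I|.-1, (xs \o e), (ys \o e); split=> [|i|x].
- by rewrite prednK.
- exact: psi_le.
- rewrite pE legendre_inner_linearization; congr EFin.
  apply/eqP; rewrite eq_le; apply/andP; split; last first.
    have [i ->] := max_aff_attained (xs \o e) (ys \o e) x.
    exact: (aff_le_max xs ys (e i)).
  have [j ->] := max_aff_attained xs ys x.
  have [i iI /le_trans] := dI x j; apply.
  have := aff_le_max (xs \o e) (ys \o e) (cast_ord mI (enum_rank_in iI i)) x.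
  by rewrite /aff /= /e cast_ordK enum_rankK_in.
Qed.

Lemma inner_linearizations_mem N psi m (zs : 'I_m.+1 -> vec) ts :
  (m < N)%N -> (forall i, (psi (zs i) <= (ts i)%:E)%E) ->
  inner_linearizations N psi (inner_linearization zs ts).
Proof.
move=> mN psi_le; split; first by exists m.+1, zs, ts.
apply: (card_le_trans (subset_card_le
  (@break_points_inner_linearization _ _ _ zs ts))).
apply: (card_le_trans (card_image_le _ _)).
by rewrite -(card_le_eql card_II) card_le_II.
Qed.

End Reduction.

(** * Averaging over the orthogonal group *)

Section Averaging.
Context {R : realType} {n : nat}.
Local Notation vec := 'cV[R]_n.
Local Notation matB := (g_sigma_algebraType (@open 'M[R]_n)).
Implicit Types psi : vec -> \bar R.

Let continuous_coord i j : continuous (fun Q : 'M[R]_n => Q i j).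
Proof. exact: coord_continuous. Qed.

Lemma continuous_inner_tr (x y : vec) :
  continuous (fun Q : 'M[R]_n => inner (Q^T *m x) y).
Proof.
pose F i j (Q : 'M[R]_n) := Q j i * (x j 0 * y i 0).
have -> : (fun Q : 'M[R]_n => inner (Q^T *m x) y) =
    (fun Q => \sum_i \sum_j F i j Q).
  apply/funext => Q; apply: eq_bigr => i _; rewrite !mxE mulr_suml.
  by apply: eq_bigr => j _; rewrite mxE -mulrA.
have cF i j : continuous (F i j).
  by move=> Q; exact: (cvgM (@continuous_coord j i Q) (cvg_cst _)).
by do 2![apply: continuous_big => [|? _]; first exact: add_continuous].
Qed.

Lemma measurable_orthogonal_group :
  measurable (@orthogonal_group R n : set matB).
Proof.
pose F i j (Q : 'M[R]_n) := \sum_k Q k i * Q k j.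
have -> : @orthogonal_group R n =
    \bigcap_(ij in [set: 'I_n * 'I_n]) (F ij.1 ij.2 @^-1` [set (ij.1 == ij.2)%:R]).
  apply/seteqP; split=> Q.
    move=> oQ [i j] _ /=; rewrite /F.
    have /matrixP/(_ i j) := oQ; rewrite !mxE => <-.
    by apply: eq_bigr => k _; rewrite mxE.
  move=> FQ; apply/matrixP => i j; rewrite !mxE -(FQ (i, j) I) /F.
  by apply: eq_bigr => k _; rewrite mxE.
have contF i j : continuous (F i j).
  apply: continuous_big => [|k _]; first exact: add_continuous.
  suff : continuous (fun Q : 'M[R]_n => Q k i * Q k j) by [].
  by move=> Q; exact: (cvgM (@continuous_coord k i Q) (@continuous_coord k j Q)).
apply: fin_bigcap_measurable; first exact: finite_finset.
move=> [i j] _ /=.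
have cF : closed (F i j @^-1` [set (i == j)%:R]).
  apply: preimage_closed => [Q _|]; first exact: contF.
  exact: closed_eq.
rewrite -[X in measurable X]setCK; apply: measurableC.
by apply: sub_sigma_algebra; exact: closed_openC.
Qed.

(** As a function of [Q] this is a supremum of continuous functions (or infinite constants), so its
    strict superlevel sets are open, even though the supremum is uncountable. *)
Lemma measurable_legendre_tr psi x :
  measurable_fun (@orthogonal_group R n : set matB)
    (fun Q : matB => legendre psi (Q^T *m x)).
Proof.
apply: (@measurable_funTS _ _ matB).
apply: (measurability _ (ErealGenOInfty.measurableE R)).
move=> /= _ [_ [a ->] <-]; rewrite setTI; apply: sub_sigma_algebra.
pose F y (Q : 'M[R]_n) := ((inner (Q^T *m x) y)%:E - psi y)%E.
rewrite (_ : _ @^-1` _ = \bigcup_(y in setT) [set Q | (a%:E < F y Q)%E]).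
  apply: bigcup_open => y _; rewrite /F.
  case: (psi y) => [r| |].
  - have -> : [set Q : 'M[R]_n | (a%:E < (inner (Q^T *m x) y)%:E - r%:E)%E] =
        (fun Q : 'M[R]_n => inner (Q^T *m x) y) @^-1` [set s | a + r < s].
      by apply/seteqP; split=> Q /=; rewrite -EFinB lte_fin ltrBrDr.
    apply: open_comp => [Q _|]; first exact: continuous_inner_tr.
    exact: open_gt.
  - rewrite (_ : mkset _ = set0) ?open0//.
    by apply/seteqP; split=> Q /=.
  - rewrite (_ : mkset _ = setT); first exact: openT.
    by apply/seteqP; split=> Q //= _; rewrite ltry.
apply/seteqP; split=> Q /=; rewrite in_itv/= andbT.
  by move=> /ereal_sup_gt[_ [y _ <-] ay]; exists y.
by move=> [y _ aF]; rewrite (lt_le_trans aF)//; apply: ereal_sup_ubound; exists y.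
Qed.

Variables (eta : probability matB R) (psi phi : vec -> \bar R).
Hypothesis etaO : eta (@orthogonal_group R n) = 1%E.
Hypothesis phiE : forall x, legendre phi x =
  (\int[eta]_(Q in orthogonal_group) legendre psi (invmx Q *m x))%E.

(** Suppose that no choice exceeds [S]. For a fixed [Q] the epigraph points can be optimized
    separately in each [i], so [S] also bounds the weighted sum of the Legendre transforms of [psi]
    at the points [Q^T *m c i]. Integrating over O(n) and applying Fenchel's inequality to [phi]
    contradicts the assumption on [S]. *)
Lemma exists_rotation_epigraph m (b : 'I_m -> R) (c xs : 'I_m -> vec) ys S :
  (exists z, psi z < +oo)%E ->
  (forall z, -oo < psi z)%E ->
  (forall i, 0 <= b i) -> (forall i, (phi (xs i) <= (ys i)%:E)%E) ->
  S < \sum_i b i * (inner (c i) (xs i) - ys i) ->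
  exists Q (zs : 'I_m -> vec) ts, [/\ orthogonal_group Q,
    forall i, (psi (zs i) <= (ts i)%:E)%E &
    S < \sum_i b i * (inner (Q^T *m c i) (zs i) - ts i)].
Proof.
move=> [z0 z0_fin] psi_gt b0 phi_le Slt; apply: contrapT => noQ.
have [t0 psiz0] : exists t0, psi z0 = t0%:E.
  by move: z0_fin (psi_gt z0); case: (psi z0) => // t0; exists t0.
have sum_le Q zs ts : orthogonal_group Q ->
    (forall i, (psi (zs i) <= (ts i)%:E)%E) ->
    \sum_i b i * (inner (Q^T *m c i) (zs i) - ts i) <= S.
  by move=> oQ zts; rewrite leNgt; apply/negP => ?; apply: noQ; exists Q, zs, ts.
pose L i (Q : 'M[R]_n) := legendre psi (Q^T *m c i).
(* The squared length of [Q^T *m c i + z0] is nonnegative; this bounds the term of the fixed point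
   [(z0, t0)] from below uniformly in [Q]. *)
pose k i := (inner (c i) (c i) + inner z0 z0) / 2 + t0.
have k_le Q i : orthogonal_group Q -> - k i <= inner (Q^T *m c i) z0 - t0.
  move=> /orthogonal_tr oQ; have := inner_ge0 (Q^T *m c i + z0).
  rewrite innerDl !innerDr inner_orthogonal// (innerC z0) /k; lra.
have L_ge Q i : orthogonal_group Q -> ((- k i)%:E <= L i Q)%E.
  move=> oQ; apply: le_trans (ereal_sup_ubound _); last by exists z0.
  by rewrite psiz0 -EFinB lee_fin k_le.
(* Putting an arbitrary epigraph point at place [i] and [(z0, t0)] at all other places turns the
   bound [S] on the sum into a bound on the single term [i], uniform in [Q]. *)
pose K i := (S + \sum_(j | j != i) b j * k j) / b i.
have epi_le Q i z t : orthogonal_group Q -> 0 < b i -> (psi z <= t%:E)%E ->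
    inner (Q^T *m c i) z - t <= K i.
  move=> oQ bi zt; rewrite ler_pdivlMr// mulrC.
  have := sum_le Q (fun j => if j == i then z else z0)
    (fun j => if j == i then t else t0) oQ.
  rewrite (bigD1 i)//= eqxx -lerBrDr => le1.
  apply: le_trans (le1 _) _ => [j|]; first by case: ifP => // _; rewrite psiz0.
  rewrite lerD2l -sumrN; apply: ler_sum => j /negPf->.
  by rewrite -mulrN ler_wpM2l// lerNl; exact: k_le.
have L_le Q i : orthogonal_group Q -> 0 < b i -> (L i Q <= (K i)%:E)%E.
  move=> oQ bi; apply: ge_ereal_sup => _ [z _ <-].
  have := @epi_le Q i z _ oQ bi; move: (psi_gt z).
  case: (psi z) => [t _ /(_ t (lexx _))| |]//=.
  by move=> _ _; rewrite leNye.
pose l i Q := fine (L i Q).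
have lE Q i : orthogonal_group Q -> 0 < b i -> L i Q = (l i Q)%:E.
  move=> oQ bi; rewrite fineK// fin_numE; apply/andP; split.
    by rewrite -ltNye (lt_le_trans _ (L_ge _ _ oQ))// ltNyr.
  by rewrite -ltey (le_lt_trans (L_le _ _ oQ bi))// ltry.
have suml_le Q : orthogonal_group Q -> \sum_(i | 0 < b i) b i * l i Q <= S.
  move=> oQ; pose B := \sum_i b i.
  have B0 : 0 <= B by exact: sumr_ge0.
  (* Points within [d] of the suprema cost [B * d <= e] in total; [B + 1] avoids a division by zero
     when all masses vanish. *)
  apply/ler_addgt0Pr => e e0; pose d := e / (B + 1).
  have d0 : 0 < d by rewrite divr_gt0// ltr_wpDl.
  have /choice[zt ztP] i : exists zt : vec * R, (psi zt.1 <= zt.2%:E)%E /\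
      (0 < b i -> l i Q - d <= inner (Q^T *m c i) zt.1 - zt.2).
    have [bi|bi] := ltP 0 (b i); last first.
      by exists (z0, t0); rewrite psiz0.
    have /ereal_sup_gt[_ [z _ <-]] : ((l i Q - d)%:E < L i Q)%E.
      by rewrite lE// lte_fin ltrBlDr ltrDl.
    move: (psi_gt z); case psiz : (psi z) => [t| |]//= _.
    rewrite -EFinB lte_fin => /ltW ?; exists (z, t) => /=; split=> //.
    by rewrite psiz.
  have := sum_le Q (fun i => (zt i).1) (fun i => (zt i).2) oQ
    (fun i => (ztP i).1).
  rewrite (bigID (fun i => 0 < b i))/= [X in _ + X]big1 ?addr0; last first.
    move=> i; rewrite lt_neqAle b0 andbT negbK => /eqP <-; exact: mul0r.
  have : \sum_(i | 0 < b i) b i * l i Q <=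
      \sum_(i | 0 < b i) b i * (inner (Q^T *m c i) (zt i).1 - (zt i).2) +
      \sum_i b i * d.
    rewrite [X in _ <= _ + X](bigID (fun i => 0 < b i))/= addrA -big_split/=.
    rewrite ler_wpDr ?sumr_ge0// => [i _|]; first by rewrite mulr_ge0// ltW.
    apply: ler_sum => i bi; rewrite -mulrDr ler_wpM2l// -lerBlDr.
    exact: (ztP i).2.
  have : \sum_i b i * d <= e.
    rewrite -mulr_suml -/B /d mulrA ler_pdivrMr ?ltr_wpDl// mulrC.
    by rewrite ler_wpM2l ?lerDl// ltW.
  lra.
have mO := measurable_orthogonal_group.
have ml i : 0 < b i -> measurable_fun (@orthogonal_group R n : set matB)
    (fun Q : matB => l i Q).
  move=> bi; apply: (@measurableT_comp _ _ _ matB (\bar R) R fine) => //.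
  exact: (measurable_legendre_tr psi (c i)).
have ll i : 0 < b i -> eta.-integrable (@orthogonal_group R n : set matB)
    (fun Q : matB => (l i Q)%:E).
  move=> bi; apply: (@measurable_bounded_integrable _ _ _ eta
    (fun Q : matB => l i Q)) => //.
  - by apply: (le_lt_trans (probability_le1 eta mO)); rewrite ltry.
  - exact: ml.
  - exists (`|k i| + `|K i|); split; first exact: num_real.
    move=> x Kx Q oQ; apply: (le_trans _ (ltW Kx)).
    have := L_ge Q i oQ; have := L_le Q i oQ bi; rewrite lE// !lee_fin => lK kl.
    rewrite ler_norml; apply/andP; split.
      by have := ler_norm (k i); have := normr_ge0 (K i); lra.
    by have := ler_norm (K i); have := normr_ge0 (k i); lra.
(* Terms with [b i = 0] are replaced by 0, because no finiteness of [L i Q] is known for them. *)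
have il i : eta.-integrable (@orthogonal_group R n : set matB)
    (fun Q : matB => (if 0 < b i then b i * l i Q else 0)%:E).
  case: ltP => [bi|_]; last exact: integrable0.
  exact: (integrableZl mO (b i) (ll i bi)).
have : (\int[eta]_(Q in (@orthogonal_group R n : set matB))
    (\sum_i (if 0 < b i then b i * l i Q else 0)%:E) <= S%:E)%E.
  have -> : S%:E = (\int[eta]_(Q in (@orthogonal_group R n : set matB)) S%:E)%E.
    rewrite integral_cst// -[LHS]mule1; congr (_ * _)%E; exact/esym/etaO.
  apply: le_integral => //.
  - exact: integrable_sum.
  - exact: (finite_measure_integrable_cst eta S mO).
  - move=> Q /set_mem oQ; rewrite sumEFin lee_fin -big_mkcond/=.
    exact: suml_le.
rewrite integral_sum//; apply/negP; rewrite -ltNge.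
apply: lt_le_trans (_ : S%:E < (\sum_i b i * (inner (c i) (xs i) - ys i))%:E)%E _.
  by rewrite lte_fin.
rewrite -sumEFin; apply: lee_sum => i _.
have [bi|] := ltP 0 (b i); last first.
  move=> bi; have -> : b i = 0 by apply/le_anti; rewrite bi b0.
  by rewrite mul0r integral0.
have -> : (\int[eta]_(Q in (@orthogonal_group R n : set matB)) (b i * l i Q)%:E =
    (b i)%:E * legendre phi (c i))%E.
  rewrite phiE; under eq_integral do rewrite EFinM.
  rewrite (integralZl mO (ll i bi)); congr (_ * _)%E.
  apply: eq_integral => Q /set_mem oQ.
  by rewrite invmx_orthogonal// -/(L i Q) lE.
rewrite EFinM lee_pmul2l//.
apply: le_trans (ereal_sup_ubound _); last by exists (xs i).
by rewrite EFinB leeB.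
Qed.

End Averaging.

(** * Translation and rotation invariance of Lebesgue measure on [R^n] *)

Section PowerMeasureIntegral.
Local Open Scope ereal_scope.
Context {d : measure_display} {T : measurableType d} {R : realType}.
Variable m : {sigma_finite_measure set T -> \bar R}.

Lemma integral_power_measureS n (F : n.+1.-tuple T -> \bar R) :
  measurable_fun setT F -> (forall t, 0 <= F t) ->
  \int[power_measure m n.+1]_t F t =
  \int[m]_x \int[power_measure m n]_t F [tuple of x :: t].
Proof.
move=> mF F0; rewrite /= ge0_integral_pushforward//=.
  rewrite preimage_setT fubini_tonelli1//.
  exact: measurableT_comp mF (@measurable_cons_pair _ _ n).
exact: measurable_cons_pair.
Qed.

Lemma integral_power_measure0 (F : 0.-tuple T -> \bar R) :
  measurable_fun setT F -> \int[power_measure m 0]_t F t = F [tuple].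
Proof. by move=> mF; rewrite /= integral_dirac// diracT mul1e. Qed.

Lemma measurable_prod_tnth n (g : T -> R) : measurable_fun setT g ->
  measurable_fun setT (fun t : n.-tuple T => \prod_(i < n) g (tnth t i))%R.
Proof.
move=> mg; apply: measurable_prod => i _; apply: measurableT_comp => //.
exact: measurable_tnth.
Qed.

Lemma integral_power_prod n (g : T -> R) :
  measurable_fun setT g -> (forall x, 0 <= g x)%R ->
  \int[power_measure m n]_t (\prod_(i < n) g (tnth t i))%:E =
  (\int[m]_x (g x)%:E) ^+ n.
Proof.
move=> mg g0.
have mP k : measurable_fun setT
    (fun t : k.-tuple T => (\prod_(i < k) g (tnth t i))%:E)%R.
  by apply/measurable_EFinP; exact: measurable_prod_tnth.
elim: n => [|n IH].
  by rewrite integral_power_measure0 ?big_ord0//; exact: mP.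
rewrite integral_power_measureS; last 2 first.
  exact: mP.
  by move=> t; rewrite lee_fin prodr_ge0.
transitivity (\int[m]_x ((g x)%:E * (\int[m]_x (g x)%:E) ^+ n)).
  apply: eq_integral => x _; rewrite -IH -ge0_integralZl//=.
  - apply: eq_integral => t _; rewrite big_ord_recl -EFinM tnth0.
    by congr (_ * _)%:E; apply: eq_bigr => i _; rewrite tnthS.
  - exact: mP.
  - by move=> t _; rewrite lee_fin prodr_ge0.
  - by rewrite lee_fin.
rewrite ge0_integralZr ?expeS//; last
  by rewrite expe_ge0// integral_ge0// => x _; rewrite lee_fin.
- exact/measurable_EFinP.
- by move=> x _; rewrite lee_fin.
Qed.

End PowerMeasureIntegral.

Section LebesgueTranslation.
Local Open Scope ereal_scope.
Context {R : realType}.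
Local Notation leb := (@lebesgue_measure R).

(** The image of Lebesgue measure under the translation gives half-open intervals their length, so
    it is Lebesgue measure by uniqueness. *)
Lemma lebesgue_translation (a : R) (F : measurableTypeR R -> \bar R) :
  measurable_fun setT F -> (forall x, 0 <= F x) ->
  \int[leb]_x F (x + a)%R = \int[leb]_x F x.
Proof.
move=> mF F0.
pose s : measurableTypeR R -> measurableTypeR R := fun x => (x + a)%R.
have ms : measurable_fun setT s by exact: measurable_funD.
transitivity (\int[pushforward leb s]_x F x).
  by rewrite ge0_integral_pushforward.
apply: eq_measure_integral => A mA _; apply/esym.
apply: (@lebesgue_measure_unique R (pushforward leb s)) => //.
move=> _ [[b c] _ <-]; rewrite /pushforward.
rewrite -[RHS]/(leb (s @^-1` `]b, c]%classic)).
rewrite (_ : s @^-1` _ = `](b - a)%R, (c - a)%R]%classic); last first.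
  by apply/seteqP; split=> x /=; rewrite !in_itv/= ltrBlDr lerBrDr.
rewrite !lebesgue_measure_itv/= !lte_fin ltrD2r.
by case: ifPn => // _; rewrite -!EFinD; congr EFin; ring.
Qed.

Lemma vec_lebesgue_translation n (v : n.-tuple (measurableTypeR R))
    (F : n.-tuple (measurableTypeR R) -> \bar R) :
  measurable_fun setT F -> (forall t, 0 <= F t) ->
  \int[vec_lebesgue n]_t F [tuple (tnth t i + tnth v i)%R | i < n] =
  \int[vec_lebesgue n]_t F t.
Proof.
have mshift k (u : k.-tuple (measurableTypeR R)) : measurable_fun setT
    (fun t : k.-tuple (measurableTypeR R) =>
      [tuple (tnth t i + tnth u i)%R | i < k] : k.-tuple (measurableTypeR R)).
  apply/measurable_fun_tnthP => i /=.
  rewrite (_ : _ \o _ = fun t => (tnth t i + tnth u i)%R); last first.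
    by apply/funext => t /=; rewrite tnth_mktuple.
  by apply: measurable_funD => //; exact: measurable_tnth.
rewrite /vec_lebesgue; elim: n => [|n IH] in v F * => mF F0.
  by apply: eq_integral => t _; congr F; rewrite (tuple0 t) [LHS]tuple0.
have mcons x : measurable_fun setT
    (fun t : n.-tuple (measurableTypeR R) => F [tuple of x :: t]).
  by apply: (measurableT_comp mF); exact: measurable_cons.
rewrite !integral_power_measureS//; last exact: measurableT_comp mF (mshift _ _).
pose F1 x := \int[power_measure leb n]_t F [tuple of x :: t].
transitivity (\int[leb]_x F1 (x + tnth v ord0)%R); last first.
  apply: (lebesgue_translation (tnth v ord0) (F := F1)) => [|x]; last first.
    exact: integral_ge0.
  apply: (measurable_fun_fubini_tonelli_F (m2 := power_measure leb n)
    (F \o (@cons_pair _ _ n))).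
    exact: measurableT_comp mF (@measurable_cons_pair _ _ n).
  by move=> z; exact: F0.
apply: eq_integral => x _.
rewrite /F1 -[RHS](IH [tuple tnth v (lift ord0 i) | i < n])//.
apply: eq_integral => t _; congr F; apply: eq_from_tnth => i.
rewrite tnth_mktuple; have [j ->|->] := unliftP ord0 i.
  by rewrite !tnthS !tnth_mktuple.
by rewrite !tnth0.
Qed.

End LebesgueTranslation.

Section VectorLebesgue.
Local Open Scope ereal_scope.
Context {R : realType} {n : nat}.
Local Notation vec := 'cV[R]_n.
Local Notation tup := (n.-tuple (measurableTypeR R)).
Local Notation vt := (@vec_of_tuple R n).
Local Notation Leb := (@vec_lebesgue R n).
Implicit Types (F : vec -> \bar R) (Q : 'M[R]_n) (v : vec).

Definition tuple_of_vec v : tup := [tuple v i 0%R | i < n].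

Lemma tuple_of_vecK : cancel tuple_of_vec vt.
Proof. by move=> v; apply/matrixP => i j; rewrite mxE tnth_mktuple ord1. Qed.

Lemma measurable_comp_vec d (X : measurableType d) F (phi : X -> vec) :
  measurable_fun setT (F \o vt) ->
  (forall i, measurable_fun setT (fun x => phi x i 0%R)) ->
  measurable_fun setT (F \o phi).
Proof.
move=> mF mphi.
have -> : F \o phi = (F \o vt) \o (tuple_of_vec \o phi).
  by apply/funext => x /=; rewrite tuple_of_vecK.
apply: (measurableT_comp mF); apply/measurable_fun_tnthP => i.
rewrite (_ : _ \o _ = fun x => phi x i 0%R)//.
by apply/funext => x /=; rewrite tnth_mktuple.
Qed.

Lemma measurable_vt_coord i : measurable_fun setT (fun t : tup => vt t i 0%R).
Proof.
rewrite (_ : (fun t => _) = (fun t : tup => tnth t i)); last first.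
  by apply/funext => t; rewrite mxE.
exact: measurable_tnth.
Qed.

Lemma measurable_mulmx_coord d (X : measurableType d) Q (phi : X -> vec) i :
  (forall i, measurable_fun setT (fun x => phi x i 0%R)) ->
  measurable_fun setT (fun x => (Q *m phi x)%R i 0%R).
Proof.
move=> mphi; rewrite (_ : (fun x => _) = (fun x => \sum_j Q i j * phi x j 0)%R).
  by apply: measurable_sum => j; exact: measurable_funM.
by apply/funext => x; rewrite mxE.
Qed.

Lemma integral_translate v F : measurable_fun setT (F \o vt) ->
  (forall x, 0 <= F x) ->
  \int[Leb]_t F (vt t + v)%R = \int[Leb]_t F (vt t).
Proof.
move=> mF F0; rewrite -(vec_lebesgue_translation (tuple_of_vec v) mF)//=.
apply: eq_integral => t _; congr F; apply/matrixP => i j.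
by rewrite ord1 !mxE !tnth_mktuple.
Qed.

Section Rotation.
Variable G : vec -> \bar R.
Hypothesis mG : measurable_fun setT (G \o vt).
Hypothesis G0 : forall x, 0 <= G x.
Hypothesis radG : forall Q x, orthogonal_group Q -> G (Q *m x)%R = G x.
Hypothesis intG0 : 0 < \int[Leb]_t G (vt t).
Hypothesis intGy : \int[Leb]_t G (vt t) < +oo.

(* Both sides times [int G] are [int int F(x) G(Q y + x) dy dx], computed by
   translating [y] by [Q^T x] first, or [x] by [- Q y]. *)
Lemma integral_rotate_opp Q F : orthogonal_group Q ->
  measurable_fun setT (F \o vt) -> (forall x, 0 <= F x) ->
  \int[Leb]_t F (vt t) = \int[Leb]_t F (- (Q *m vt t))%R.
Proof.
move=> oQ mF F0; have QQ : (Q *m Q^T = 1%:M)%R by exact: mulmx1C.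
pose IG := \int[Leb]_t G (vt t).
have fG : IG \is a fin_num by rewrite ge0_fin_numE// integral_ge0.
pose H (z : tup * tup) := F (vt z.1) * G (vt z.1 + Q *m vt z.2)%R.
have m1 i : measurable_fun setT (fun z : tup * tup => vt z.1 i 0%R).
  exact: measurableT_comp (measurable_vt_coord i) _.
have m2 i : measurable_fun setT (fun z : tup * tup => vt z.2 i 0%R).
  exact: measurableT_comp (measurable_vt_coord i) _.
have mQ2 i : measurable_fun setT (fun z : tup * tup => (Q *m vt z.2)%R i 0%R).
  exact: measurable_mulmx_coord.
have mH : measurable_fun setT H.
  apply: emeasurable_funM; first exact: (measurable_comp_vec mF m1).
  apply: (measurable_comp_vec mG) => i.
  rewrite (_ : (fun x => _) = (fun x => vt x.1 i 0 + (Q *m vt x.2) i 0)%R).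
    exact: measurable_funD.
  by apply/funext => z; rewrite mxE.
have H0 z : 0 <= H z by exact: mule_ge0.
have mGc x : measurable_fun setT (fun t : tup => G (x + Q *m vt t)%R).
  apply: (measurable_comp_vec mG) => i.
  rewrite (_ : (fun t => _) = (fun t => x i 0 + (Q *m vt t) i 0)%R).
    apply: measurable_funD => //; apply: measurable_mulmx_coord => j.
    exact: measurable_vt_coord.
  by apply/funext => z; rewrite mxE.
have mFc : measurable_fun setT (fun t : tup => F (- (Q *m vt t))%R).
  apply: (measurable_comp_vec mF) => i.
  rewrite (_ : (fun t => _) = (fun t => - (Q *m vt t) i 0)%R).
    apply: measurableT_comp => //; apply: measurable_mulmx_coord => j.
    exact: measurable_vt_coord.
  by apply/funext => z; rewrite mxE.
have eq1 : \int[Leb]_x \int[Leb]_y H (x, y) = (\int[Leb]_t F (vt t)) * IG.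
  rewrite -ge0_integralZr//; last exact: integral_ge0.
  apply: eq_integral => x _; rewrite /H/= ge0_integralZl//.
  congr (_ * _); pose G' z := G (vt x + Q *m z)%R.
  rewrite -(@integral_translate (- (Q^T *m vt x))%R G').
  - apply: eq_integral => y _; rewrite /G' mulmxDr mulmxN mulmxA QQ mul1mx.
    by rewrite addrC subrK radG.
  - exact: mGc.
  - by move=> z; exact: G0.
have eq2 : \int[Leb]_y \int[Leb]_x H (x, y) =
    IG * (\int[Leb]_t F (- (Q *m vt t))%R).
  transitivity (\int[Leb]_y \int[Leb]_x (F (vt x - Q *m vt y)%R * G (vt x))).
    apply: eq_integral => y _; pose H' z := F z * G (z + Q *m vt y)%R.
    rewrite -[LHS](@integral_translate (- (Q *m vt y))%R H').
    - by apply: eq_integral => x _; rewrite /H' subrK.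
    - apply: emeasurable_funM => //; apply: (measurable_comp_vec mG) => i.
      rewrite (_ : (fun x => _) = (fun x => vt x i 0 + (Q *m vt y) i 0)%R).
        by apply: measurable_funD => //; exact: measurable_vt_coord.
      by apply/funext => z; rewrite mxE.
    - by move=> x; exact: mule_ge0.
  pose K (z : tup * tup) := F (vt z.1 - Q *m vt z.2)%R * G (vt z.1).
  have mK : measurable_fun setT K.
    apply: emeasurable_funM; last exact: (measurable_comp_vec mG m1).
    apply: (measurable_comp_vec mF) => i.
    rewrite (_ : (fun x => _) = (fun x => vt x.1 i 0 - (Q *m vt x.2) i 0)%R).
      exact: measurable_funB.
    by apply/funext => z; rewrite !mxE.
  rewrite -(fubini_tonelli (m1 := Leb) (m2 := Leb) K)//; last first.
    by move=> z; exact: mule_ge0.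
  rewrite -ge0_integralZr//; last exact: integral_ge0.
  apply: eq_integral => x _; rewrite /K/=.
  pose F' z := F (vt x - Q *m z)%R.
  have mF' : measurable_fun setT (F' \o vt).
    apply: (measurable_comp_vec mF) => i.
    rewrite (_ : (fun t => _) = (fun t => vt x i 0 - (Q *m vt t) i 0)%R).
      apply: measurable_funB => //; apply: measurable_mulmx_coord => j.
      exact: measurable_vt_coord.
    by apply/funext => z; rewrite !mxE.
  rewrite ge0_integralZr//.
  rewrite muleC; congr (_ * _).
  rewrite -(@integral_translate (Q^T *m vt x)%R F')//; last by move=> z; exact: F0.
  apply: eq_integral => y _; rewrite /F' mulmxDr mulmxA QQ mul1mx.
  by rewrite opprD addrCA subrr addr0.
have : (\int[Leb]_t F (vt t)) * IG = (\int[Leb]_t F (- (Q *m vt t))%R) * IG.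
  by rewrite -eq1 (fubini_tonelli (m1 := Leb) (m2 := Leb) H)// eq2 muleC.
have [r ] : exists r, IG = r%:E by exists (fine IG); rewrite fineK.
rewrite /IG => rE; rewrite rE; move: intG0; rewrite rE lte_fin => r0.
move=> /(congr1 (fun u => u * r^-1%:E)); rewrite -!muleA -EFinM.
by rewrite divff ?gt_eqF// !mule1.
Qed.

End Rotation.

End VectorLebesgue.

(** * Gaussian density and rotation invariance *)

Section Gaussian.
Local Open Scope ereal_scope.
Context {R : realType}.
Local Notation leb := (@lebesgue_measure R).
Local Notation pdf := (@normal_pdf R 0 1).

(** The Radon-Nikodym derivative and [pdf] have the same integral over every measurable set, hence
    agree almost everywhere. *)
Lemma integral_normal_prob (f : measurableTypeR R -> \bar R) :
  measurable_fun setT f -> (forall x, 0 <= f x) ->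
  \int[@normal_prob R 0 1]_x f x = \int[leb]_x (f x * (pdf x)%:E).
Proof.
move=> mf f0; have dom := @normal_prob_dominates R 0 1.
have mpdf : measurable_fun setT (fun x : measurableTypeR R => (pdf x)%:E).
  by apply/measurable_EFinP; exact: measurable_normal_pdf.
rewrite -(Radon_Nikodym_SigmaFinite.change_of_variables dom)//.
have mRN := measurable_int _ (Radon_Nikodym_SigmaFinite.f_integrable dom).
apply: ae_eq_integral => //.
- exact: emeasurable_funM.
- exact: emeasurable_funM.
- apply: ae_eqe_mul2l; apply: integral_ae_eq => //=.
  + exact: Radon_Nikodym_SigmaFinite.f_integrable.
  + by move=> E _ mE; rewrite -Radon_Nikodym_SigmaFinite.f_integral.
Qed.

Lemma integral_vec_gauss n (F : n.-tuple (measurableTypeR R) -> \bar R) :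
  measurable_fun setT F -> (forall t, 0 <= F t) ->
  \int[vec_gauss n]_t F t =
  \int[vec_lebesgue n]_t (F t * (\prod_(i < n) pdf (tnth t i))%:E).
Proof.
have mP k : measurable_fun setT
    (fun t : k.-tuple (measurableTypeR R) => (\prod_(i < k) pdf (tnth t i))%:E)%R.
  apply/measurable_EFinP; apply: (@measurable_prod_tnth _ (measurableTypeR R)).
  exact: measurable_normal_pdf.
have P0 k (t : k.-tuple (measurableTypeR R)) :
    0 <= (\prod_(i < k) pdf (tnth t i))%:E.
  by rewrite lee_fin prodr_ge0// => i _; exact: normal_pdf_ge0.
have mFP k (H : k.-tuple (measurableTypeR R) -> \bar R) : measurable_fun setT H ->
    measurable_fun setT (fun t => H t * (\prod_(i < k) pdf (tnth t i))%:E).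
  by move=> mH; apply: emeasurable_funM => //; exact: mP.
rewrite /vec_gauss /vec_lebesgue; elim: n => [|n IH] in F * => mF F0.
  rewrite !integral_power_measure0//; last exact: mFP.
  by rewrite big_ord0 mule1.
have mcons x : measurable_fun setT
    (fun t : n.-tuple (measurableTypeR R) => F [tuple of x :: t]).
  by apply: (measurableT_comp mF); exact: measurable_cons.
rewrite !integral_power_measureS//; last 2 first.
- exact: mFP.
- by move=> t; exact: mule_ge0.
under eq_integral do rewrite IH//.
pose K (z : measurableTypeR R * n.-tuple (measurableTypeR R)) :=
  F [tuple of z.1 :: z.2] * (\prod_(i < n) pdf (tnth z.2 i))%:E.
have mK : measurable_fun setT K.
  apply: emeasurable_funM.
    exact: measurableT_comp mF (@measurable_cons_pair _ _ n).
  exact: measurableT_comp (mP n) _.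
have K0 z : 0 <= K z by exact: mule_ge0.
rewrite (integral_normal_prob (f := fun x => \int[power_measure leb n]_t K (x, t))).
- apply: eq_integral => x _; rewrite -ge0_integralZr//; last 2 first.
  + by apply: (measurableT_comp mK); exact: measurable_pair1.
  + by rewrite lee_fin normal_pdf_ge0.
  apply: eq_integral => t _; rewrite /K/= -muleA; congr (_ * _).
  rewrite -EFinM big_ord_recl tnth0 mulrC; congr (_ * _)%:E.
  by apply: eq_bigr => i _; rewrite tnthS.
- exact: (measurable_fun_fubini_tonelli_F (m2 := power_measure leb n) K).
- by move=> x; exact: integral_ge0.
Qed.

Lemma integral_vec_gauss_signed n (F : n.-tuple (measurableTypeR R) -> \bar R) :
  measurable_fun setT F ->
  \int[vec_gauss n]_t F t =
  \int[vec_lebesgue n]_t (F t * (\prod_(i < n) pdf (tnth t i))%:E).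
Proof.
move=> mF.
have P0 (t : n.-tuple (measurableTypeR R)) : (0 <= \prod_(i < n) pdf (tnth t i))%R.
  by rewrite prodr_ge0// => i _; exact: normal_pdf_ge0.
rewrite integralE [RHS]integralE !integral_vec_gauss//.
- congr (_ - _); apply: eq_integral => t _.
    by rewrite !funeposE maxe_pMl ?lee_fin// mul0e.
  by rewrite !funenegE maxe_pMl ?lee_fin// mul0e mulNe.
- exact: measurable_funeneg.
- exact: measurable_funepos.
Qed.

Context {n : nat}.
Local Notation tup := (n.-tuple (measurableTypeR R)).
Local Notation vec := 'cV[R]_n.
Local Notation vt := (@vec_of_tuple R n).
Local Notation Leb := (@vec_lebesgue R n).
Implicit Types (F : vec -> \bar R) (Q : 'M[R]_n).

Definition gauss_density (x : vec) : R := (\prod_i pdf (x i 0))%R.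

Lemma gauss_density_ge0 x : (0 <= gauss_density x)%R.
Proof. by apply: prodr_ge0 => i _; exact: normal_pdf_ge0. Qed.

Lemma gauss_density_vt (t : tup) :
  gauss_density (vt t) = (\prod_(i < n) pdf (tnth t i))%R.
Proof. by apply: eq_bigr => i _; rewrite mxE. Qed.

Lemma measurable_gauss_density : measurable_fun setT (gauss_density \o vt).
Proof.
rewrite (_ : _ \o _ = fun t => (\prod_(i < n) pdf (tnth t i))%R).
  apply: (@measurable_prod_tnth _ (measurableTypeR R)).
  exact: measurable_normal_pdf.
by apply/funext => t /=; rewrite gauss_density_vt.
Qed.

(** The product of the one-dimensional densities depends on [x] only through [inner x x], which
    makes it radial. *)
Lemma gauss_densityE x :
  gauss_density x = (normal_peak 1 ^+ n * expR (- (inner x x / 2)))%R.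
Proof.
rewrite /gauss_density normal_pdfE ?oner_neq0// big_split/= prodr_const card_ord.
congr (_ * _)%R; rewrite /normal_fun -expR_sum; congr expR.
rewrite /inner mulr_suml -sumrN; apply: eq_bigr => i _.
by rewrite subr0 expr1n mulNr -expr2.
Qed.

Lemma gauss_density_radial Q x : orthogonal_group Q ->
  gauss_density (Q *m x)%R = gauss_density x.
Proof. by move=> oQ; rewrite !gauss_densityE inner_orthogonal. Qed.

Lemma integral_gauss_density : \int[Leb]_t (gauss_density (vt t))%:E = 1.
Proof.
under eq_integral do rewrite gauss_density_vt.
rewrite [LHS](@integral_power_prod _ (measurableTypeR R)).
- by rewrite integral_normal_pdf -EFin_expe expr1n.
- exact: measurable_normal_pdf.
- by move=> x; exact: normal_pdf_ge0.
Qed.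

(** The Gaussian density is a radial [G] with positive finite integral, as [integral_rotate_opp]
    requires; that lemma is applied to the orthogonal matrix [- Q] to cancel its sign. *)
Lemma integral_rotate Q F : orthogonal_group Q ->
  measurable_fun setT (F \o vt) -> (forall x, 0 <= F x) ->
  \int[Leb]_t F (Q *m vt t)%R = \int[Leb]_t F (vt t).
Proof.
move=> oQ mF F0.
rewrite [RHS](@integral_rotate_opp _ _ (EFin \o gauss_density) _ _ _ _ _ (- Q)%R)//.
- by apply: eq_integral => t _; rewrite mulNmx opprK.
- by apply/measurable_EFinP; exact: measurable_gauss_density.
- by move=> x; rewrite lee_fin gauss_density_ge0.
- by move=> P x oP /=; rewrite gauss_density_radial.
- by rewrite integral_gauss_density.
- by rewrite integral_gauss_density ltry.
- have trN : ((- Q)^T = - Q^T)%R by apply/matrixP => i j; rewrite !mxE.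
  by rewrite /orthogonal_group/= trN mulNmx mulmxN opprK.
Qed.

Lemma integral_rotate_signed Q F : orthogonal_group Q ->
  measurable_fun setT (F \o vt) ->
  \int[Leb]_t F (Q *m vt t)%R = \int[Leb]_t F (vt t).
Proof.
move=> oQ mF; rewrite integralE [RHS]integralE; congr (_ - _).
  transitivity (\int[Leb]_t F^\+ (Q *m vt t)%R).
    by apply: eq_integral => t _; rewrite !funeposE.
  rewrite integral_rotate//; last first.
    by rewrite -funepos_comp; exact: measurable_funepos.
  by apply: eq_integral => t _; rewrite !funeposE.
transitivity (\int[Leb]_t F^\- (Q *m vt t)%R).
  by apply: eq_integral => t _; rewrite !funenegE.
rewrite integral_rotate//; last first.
  by rewrite -funeneg_comp; exact: measurable_funeneg.
by apply: eq_integral => t _; rewrite !funenegE.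
Qed.

End Gaussian.

(** * Subgradients of the weighted width *)

Lemma Rintegral_sumZl d (T : measurableType d) (R : realType)
    (mu : {measure set T -> \bar R}) (I : finType) (c : I -> R) (f : I -> T -> R) :
  (forall i, mu.-integrable setT (EFin \o f i)) ->
  \int[mu]_x (\sum_i c i * f i x) = \sum_i c i * \int[mu]_x f i x.
Proof.
move=> intf; rewrite /Rintegral.
under eq_integral do rewrite -sumEFin.
under eq_integral do under eq_bigr do rewrite EFinM.
rewrite integral_sum//=; last by move=> i; exact: (integrableZl _ (c i) (intf i)).
under eq_bigr => i _ do rewrite (integralZl measurableT (intf i))
  -(fineK (integrable_fin_num measurableT (intf i))) -EFinM.
by rewrite sumEFin.
Qed.

Section ArgmaxWeights.
Context {R : realType} {n : nat} (m : nat).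
Local Notation vec := 'cV[R]_n.
Local Notation tup := (n.-tuple (measurableTypeR R)).
Local Notation vt := (@vec_of_tuple R n).
Variables (xs : 'I_m.+1 -> vec) (ys : 'I_m.+1 -> R).

(** Cells overlap on ties, and on all of space when two data points coincide. Normalizing these
    indicators into a partition of unity makes it unnecessary to show that ties are negligible. *)
Definition is_argmax i (x : vec) : R := (aff xs ys i x == max_aff xs ys x)%:R.

(* Ties are shared equally. *)
Definition argmax_weight i (x : vec) : R :=
  is_argmax i x * (\sum_j is_argmax j x)^-1.

Lemma argmax_count_gt0 x : 0 < \sum_j is_argmax j x.
Proof.
have [i mi] := max_aff_attained xs ys x.
rewrite (bigD1 i)//= {1}/is_argmax mi eqxx ltr_pwDl//.
by apply: sumr_ge0 => j _; exact: ler0n.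
Qed.

Lemma argmax_weight_ge0 i x : 0 <= argmax_weight i x.
Proof. by rewrite mulr_ge0 ?ler0n// invr_ge0 ltW// argmax_count_gt0. Qed.

Lemma sum_argmax_weight x : \sum_i argmax_weight i x = 1.
Proof. by rewrite -mulr_suml mulfV// gt_eqF// argmax_count_gt0. Qed.

Lemma argmax_weight_le1 i x : argmax_weight i x <= 1.
Proof.
rewrite -(sum_argmax_weight x) (bigD1 i)//= lerDl.
by apply: sumr_ge0 => j _; exact: argmax_weight_ge0.
Qed.

Lemma argmax_weight_max x :
  \sum_i argmax_weight i x * aff xs ys i x = max_aff xs ys x.
Proof.
rewrite -[RHS]mul1r -(sum_argmax_weight x) mulr_suml; apply: eq_bigr => i _.
rewrite /argmax_weight /is_argmax; case: eqP => [->//|_].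
by rewrite !mul0r.
Qed.

Lemma measurable_aff i : measurable_fun setT (aff xs ys i \o vt).
Proof.
apply: measurable_funB => //; apply: measurable_sum => j.
by apply: measurable_funM => //; exact: measurable_vt_coord.
Qed.

Lemma measurable_max_aff : measurable_fun setT (max_aff xs ys \o vt).
Proof.
rewrite (_ : _ \o _ = fun t => \big[Order.max/aff xs ys ord0 (vt t)]_(i < m.+1)
  aff xs ys i (vt t))//.
elim: (index_enum _) => [|i s IH].
  under eq_fun do rewrite big_nil.
  exact: measurable_aff.
under eq_fun do rewrite big_cons.
by apply: measurable_maxr => //; exact: measurable_aff.
Qed.

Lemma measurable_is_argmax i : measurable_fun setT (is_argmax i \o vt).
Proof.
pose D (t : tup) := max_aff xs ys (vt t) - aff xs ys i (vt t).
rewrite (_ : _ \o _ = \1_(D @^-1` [set 0])).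
  apply: measurable_indic; rewrite -[X in measurable X]setTI.
  have mD : measurable_fun setT D.
    exact: measurable_funB measurable_max_aff (measurable_aff i).
  by apply: mD => //; exact: measurable_set1.
apply/funext => t; rewrite indicE /is_argmax/=; congr (nat_of_bool _)%:R.
apply/eqP/idP => [e|]; first by rewrite inE /D/= e subrr.
by rewrite inE /D/= => /eqP; rewrite subr_eq0 => /eqP.
Qed.

Lemma measurable_argmax_weight i : measurable_fun setT (argmax_weight i \o vt).
Proof.
apply: measurable_funM; first exact: measurable_is_argmax.
rewrite (_ : (fun _ => _) = fun t => (\sum_j is_argmax j (vt t)) `^ (-1)).
  apply: (@measurableT_comp _ _ _ _ _ _ (@powR R ^~ (-1))).
    exact: measurable_powR.
  by apply: measurable_sum => j; exact: measurable_is_argmax.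
by apply/funext => t; rewrite powR_inv1// ltW// argmax_count_gt0.
Qed.

End ArgmaxWeights.

Section WeightedWidth.
Context {R : realType} {n : nat}.
Local Notation vec := 'cV[R]_n.
Local Notation tup := (n.-tuple (measurableTypeR R)).
Local Notation vt := (@vec_of_tuple R n).
Local Notation Leb := (@vec_lebesgue R n).
Variable w : vec -> R.
Hypothesis w0 : forall x, 0 <= w x.
Hypothesis radw : forall Q x, orthogonal_group Q -> w (Q *m x) = w x.
Hypothesis intw : Leb.-integrable setT (fun t => (w (vt t))%:E).
Hypothesis intxw : forall k, Leb.-integrable setT (fun t => (vt t k 0 * w (vt t))%:E).

Lemma integrable_weight (chi : vec -> R) (f : vec -> R) :
  measurable_fun setT (chi \o vt) -> (forall x, 0 <= chi x <= 1) ->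
  Leb.-integrable setT (fun t => (f (vt t))%:E) ->
  Leb.-integrable setT (fun t => (chi (vt t) * f (vt t))%:E).
Proof.
move=> mchi chi01 intf; apply: (le_integrable measurableT _ _ intf).
  apply/measurable_EFinP; apply: measurable_funM => //.
  by apply/measurable_EFinP; exact: measurable_int intf.
move=> t _; have /andP[chi0 chi1] := chi01 (vt t).
by rewrite lee_fin normrM ger0_norm// ler_piMl.
Qed.

Lemma integrable_aff_weight (z : vec) (s : R) :
  Leb.-integrable setT (fun t => ((inner (vt t) z - s) * w (vt t))%:E).
Proof.
have -> : (fun t : tup => ((inner (vt t) z - s) * w (vt t))%:E) =
    (fun t => \sum_k (z k 0)%:E * (vt t k 0 * w (vt t))%:E + (- s)%:E * (w (vt t))%:E)%E.
  apply/funext => t; under eq_bigr do rewrite -EFinM.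
  rewrite sumEFin -EFinM -EFinD; congr EFin.
  rewrite mulrBl mulNr mulr_suml; congr (_ - _); apply: eq_bigr => k _; ring.
apply: integrableD => //; last exact: (integrableZl measurableT _ intw).
by apply: integrable_sum => // k _; exact: (integrableZl measurableT _ (intxw k)).
Qed.

(** The maximum is the combination of the affine functions with weights [argmax_weight], which lie
    in [0, 1], so every term is dominated by an integrable one. *)
Lemma integrable_max_aff_weight m (xs : 'I_m.+1 -> vec) ys :
  Leb.-integrable setT (fun t => (max_aff xs ys (vt t) * w (vt t))%:E).
Proof.
have -> : (fun t : tup => (max_aff xs ys (vt t) * w (vt t))%:E) =
    (fun t => \sum_i (argmax_weight xs ys i (vt t) * (aff xs ys i (vt t) * w (vt t)))%:E)%E.
  apply/funext => t; rewrite sumEFin -argmax_weight_max mulr_suml; congr EFin.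
  by apply: eq_bigr => i _; rewrite mulrA.
apply: integrable_sum => // i _.
apply: (integrable_weight (chi := argmax_weight xs ys i)
  (f := fun x => aff xs ys i x * w x)).
- exact: measurable_argmax_weight.
- by move=> x; rewrite argmax_weight_ge0 argmax_weight_le1.
- exact: integrable_aff_weight.
Qed.

Lemma width_rotate m (zs : 'I_m.+1 -> vec) ts Q : orthogonal_group Q ->
  \int[Leb]_t (max_aff (fun i => Q *m zs i) ts (vt t) * w (vt t)) =
  \int[Leb]_t (max_aff zs ts (vt t) * w (vt t)).
Proof.
move=> oQ; rewrite /Rintegral; congr fine.
rewrite -(integral_rotate_signed (F := fun x => (max_aff zs ts x * w x)%:E)
  (orthogonal_tr oQ)); last first.
  exact: measurable_int (integrable_max_aff_weight zs ts).
apply: eq_integral => t _; rewrite radw; last exact: orthogonal_tr.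
congr EFin; congr (_ * _).
rewrite /max_aff /aff inner_mulmx_tr trmxK; apply: eq_bigr => i _.
by rewrite inner_mulmx_tr trmxK.
Qed.

Section Subgradient.
Variables (m : nat) (xs : 'I_m.+1 -> vec) (ys : 'I_m.+1 -> R).
Local Notation chi := (argmax_weight xs ys).

(** The numbers [b_i]; [cell_moment] below is [b_i c_i], which makes sense also for a cell of mass
    zero. *)
Definition cell_mass i : R := \int[Leb]_t (chi i (vt t) * w (vt t)).
Definition cell_moment i : vec :=
  \col_k \int[Leb]_t (chi i (vt t) * (vt t k 0 * w (vt t))).

Let chi01 i x : 0 <= chi i x <= 1.
Proof. by rewrite argmax_weight_ge0 argmax_weight_le1. Qed.

Let intchiw i : Leb.-integrable setT (fun t => (chi i (vt t) * w (vt t))%:E).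
Proof.
by apply: integrable_weight => //; exact: measurable_argmax_weight.
Qed.

Let intchixw i k :
  Leb.-integrable setT (fun t => (chi i (vt t) * (vt t k 0 * w (vt t)))%:E).
Proof.
apply: (integrable_weight (f := fun x => x k 0 * w x)) => //.
exact: measurable_argmax_weight.
Qed.

Lemma integral_cell_aff i (z : vec) s :
  \int[Leb]_t (chi i (vt t) * ((inner (vt t) z - s) * w (vt t))) =
  inner (cell_moment i) z - cell_mass i * s.
Proof.
(* The mass term sits at [ord0] and the [n] coordinates at the lifted indices, so that linearity is
   used on a single sum. *)
pose f (o : 'I_n.+1) (t : tup) := if unlift ord0 o is Some k
  then chi i (vt t) * (vt t k 0 * w (vt t)) else chi i (vt t) * w (vt t).
pose c (o : 'I_n.+1) := if unlift ord0 o is Some k then z k 0 else - s.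
transitivity (\int[Leb]_t (\sum_o c o * f o t)).
  apply: eq_Rintegral => t _; rewrite big_ord_recl /c /f unlift_none.
  rewrite mulrBl mulrBr mulr_suml mulr_sumr addrC; congr (_ + _); first by ring.
  by apply: eq_bigr => k _; rewrite liftK; ring.
rewrite Rintegral_sumZl; last first.
  by move=> o; rewrite /f; case: (unlift ord0 o) => [k|]; [exact: intchixw|exact: intchiw].
rewrite big_ord_recl /c /f unlift_none addrC.
congr (_ + _); last by rewrite mulNr mulrC.
by apply: eq_bigr => k _; rewrite liftK mxE mulrC.
Qed.

Lemma width_cells (zs : 'I_m.+1 -> vec) ts :
  \sum_i \int[Leb]_t (chi i (vt t) * (aff zs ts i (vt t) * w (vt t))) =
  \int[Leb]_t (\sum_i 1 * (chi i (vt t) * (aff zs ts i (vt t) * w (vt t)))).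
Proof.
rewrite Rintegral_sumZl; first by apply: eq_bigr => i _; rewrite mul1r.
move=> i; apply: (integrable_weight (chi := chi i) (f := fun x => aff zs ts i x * w x)) => //.
  exact: measurable_argmax_weight.
exact: integrable_aff_weight.
Qed.

(** The weights [chi] of [xs, ys] sum to 1, so averaging the functions [aff zs ts i] with them stays
    below their maximum. For [xs, ys] themselves the average is the maximum, whence
    [width_subgradient_eq]. *)
Lemma width_subgradient (zs : 'I_m.+1 -> vec) ts :
  \sum_i (inner (cell_moment i) (zs i) - cell_mass i * ts i) <=
  \int[Leb]_t (max_aff zs ts (vt t) * w (vt t)).
Proof.
under eq_bigr do rewrite -integral_cell_aff.
rewrite [leLHS]width_cells; apply: le_Rintegral => //.
- rewrite (_ : _ \o _ =
      fun t => \sum_i (chi i (vt t) * (aff zs ts i (vt t) * w (vt t)))%:E)%E.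
    2: by apply/funext => t /=; rewrite sumEFin; under eq_bigr do rewrite mul1r.
  apply: integrable_sum => // i _.
  apply: (integrable_weight (chi := chi i) (f := fun x => aff zs ts i x * w x)) => //.
    exact: measurable_argmax_weight.
  exact: integrable_aff_weight.
- exact: integrable_max_aff_weight.
- move=> t _; have -> : max_aff zs ts (vt t) * w (vt t) =
      \sum_i chi i (vt t) * (max_aff zs ts (vt t) * w (vt t)).
    by rewrite -mulr_suml sum_argmax_weight mul1r.
  apply: ler_sum => i _; rewrite mul1r ler_wpM2l ?argmax_weight_ge0//.
  by rewrite ler_wpM2r// aff_le_max.
Qed.

Lemma width_subgradient_eq :
  \int[Leb]_t (max_aff xs ys (vt t) * w (vt t)) =
  \sum_i (inner (cell_moment i) (xs i) - cell_mass i * ys i).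
Proof.
under [RHS]eq_bigr do rewrite -integral_cell_aff.
rewrite [RHS]width_cells; apply: eq_Rintegral => t _.
rewrite -argmax_weight_max mulr_suml; apply: eq_bigr => i _.
by rewrite mul1r mulrA.
Qed.

Lemma cell_mass_ge0 i : 0 <= cell_mass i.
Proof.
by apply: Rintegral_ge0 => t _; rewrite mulr_ge0// argmax_weight_ge0.
Qed.

(** A nonnegative integrand with zero integral vanishes almost everywhere, and so does its product
    with a coordinate. This lets null cells be written as mass times centroid too. *)
Lemma cell_mass0 i : cell_mass i = 0 -> cell_moment i = 0.
Proof.
move=> mass0; apply/matrixP => k j; rewrite !mxE /Rintegral.
have mcw := measurable_int _ (intchiw i).
have int0 : (\int[Leb]_t `|(chi i (vt t) * w (vt t))%:E| = 0)%E.
  transitivity (\int[Leb]_t (chi i (vt t) * w (vt t))%:E)%E.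
    apply: eq_integral => t _.
    by rewrite gee0_abs// lee_fin mulr_ge0// argmax_weight_ge0.
  rewrite -(fineK (integrable_fin_num measurableT (intchiw i))).
  by rewrite -[fine _]/(cell_mass i) mass0.
have ae0 := (ae_eq_integral_abs Leb measurableT mcw).1 int0.
rewrite (ae_eq_integral (cst 0%E))//; first by rewrite integral0.
- exact: measurable_int (intchixw i k).
- move: ae0; apply: filterS => t /= + _ => /(_ I) [cw0].
  by rewrite mulrCA cw0 mulr0.
Qed.

End Subgradient.

Lemma width_averaging (eta : probability (g_sigma_algebraType (@open 'M[R]_n)) R)
    (psi phi : vec -> \bar R) m (xs : 'I_m.+1 -> vec) ys S :
  eta orthogonal_group = 1%E ->
  (forall x, legendre phi x =
    (\int[eta]_(Q in orthogonal_group) legendre psi (invmx Q *m x))%E) ->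
  (exists z, psi z < +oo)%E -> (forall z, -oo < psi z)%E ->
  (forall i, (phi (xs i) <= (ys i)%:E)%E) ->
  S < \int[Leb]_t (max_aff xs ys (vt t) * w (vt t)) ->
  exists (zs : 'I_m.+1 -> vec) ts, (forall i, (psi (zs i) <= (ts i)%:E)%E) /\
    S < \int[Leb]_t (max_aff zs ts (vt t) * w (vt t)).
Proof.
move=> etaO phiE psi_fin psi_gt phi_le.
pose b := cell_mass xs ys; pose a := cell_moment xs ys.
(* For a null cell the inverse is 0 by convention and [c i = 0]; [aE] then rests on [cell_mass0]. *)
pose c i := (b i)^-1 *: a i.
have aE i : a i = b i *: c i.
  have [b0|b0] := eqVneq (b i) 0; last by rewrite scalerA mulfV// scale1r.
  by rewrite b0 scale0r; exact: cell_mass0.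
have sumE (us : 'I_m.+1 -> vec) ts : \sum_i (inner (a i) (us i) - b i * ts i) =
    \sum_i b i * (inner (c i) (us i) - ts i).
  by apply: eq_bigr => i _; rewrite aE innerZl -mulrBr.
rewrite width_subgradient_eq [X in _ < X]sumE => Slt.
have [Q [zs [ts [oQ psi_le]]]] := exists_rotation_epigraph etaO phiE psi_fin
  psi_gt (cell_mass_ge0 xs ys) phi_le Slt.
under eq_bigr do rewrite inner_mulmx_tr trmxK.
move=> Slt'; exists zs, ts; split=> //; rewrite -(width_rotate _ _ oQ).
apply: lt_le_trans (width_subgradient xs ys _ _).
by rewrite [X in _ < X]sumE.
Qed.

End WeightedWidth.

(** * Integrability of the weights *)

Section PowerDecay.
Context {R : realType}.
Local Notation leb := (@lebesgue_measure R).
Variable p : R.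
Hypothesis p1 : (1 < p)%R.

Let gt0_powR_cvg0 : (x `^ (1 - p))%R @[x --> +oo%R] --> (0 : R)%R.
Proof.
apply/cvgrPdist_le => e e0; near=> x.
pose M := e `^ (1 - p)^-1.
have eM : e = M `^ (1 - p).
  by rewrite -powRrM mulVf ?powRr1 ?ltW// lt_eqF// subr_lt0.
have M0 : 0 < M by rewrite powR_gt0.
have x0 : 0 < x by near: x; exact: nbhs_pinfty_gt.
rewrite sub0r normrN ger0_norm ?powR_ge0// eM.
rewrite -(opprB p 1) !powRN lef_pV2 ?posrE ?powR_gt0//.
have Mx : M <= x by near: x; apply: nbhs_pinfty_ge; exact: num_real.
by apply: ge0_ler_powR; rewrite ?nnegrE ?subr_ge0 // ltW.
Unshelve. all: by end_near. Qed.

Lemma integral_powR_itv1y :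
  (\int[leb]_(x in `[1%R, +oo[) (x `^ (- p))%:E = ((p - 1)^-1)%:E)%E.
Proof.
have p10 : (1 - p != 0)%R by rewrite lt_eqF// subr_lt0.
pose F (x : R) : R := ((1 - p)^-1 * x `^ (1 - p))%R.
have dF (x : R) : (0 < x)%R -> is_derive x 1 F (x `^ (- p))%R.
  move=> x0; rewrite (_ : x `^ (- p) = (1 - p)^-1 * ((1 - p) * x `^ (1 - p - 1)))%R.
    exact: (is_deriveZ (1 - p)^-1 (is_derive1_powR (1 - p) x0)).
  by rewrite mulrA mulVf// mul1r addrAC subrr sub0r.
have cF (x : R) : (0 < x)%R -> {for x, continuous F}.
  by move=> /dF[dFx _]; apply: differentiable_continuous; exact/derivable1_diffP.
rewrite (@ge0_continuous_FTC2y _ _ F _ 0%R).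
- by rewrite -EFinB /F powR1 mulr1 sub0r -invrN opprB.
- by move=> x _; exact: powR_ge0.
- apply: derivable_within_continuous => x; rewrite in_itv/= andbT => x1.
  by apply: derivable_powR; rewrite in_itv/= andbT (lt_le_trans _ x1).
- rewrite /F -[X in _ --> X](mulr0 (1 - p)^-1)%R.
  by apply: cvgMr; exact: gt0_powR_cvg0.
- by move=> x x1; have [] := dF x (lt_trans ltr01 x1).
- by apply: cvg_at_right_filter; apply: cF.
- move=> x; rewrite in_itv/= andbT => x1; rewrite derive1E.
  by have [] := dF x (lt_trans ltr01 x1).
Qed.

(** By symmetry this is twice an integral over the half-line, and a translation by 1 reduces it to
    [integral_powR_itv1y]. *)
Lemma integral_power_decay_lty :
  (\int[leb]_x ((1 + `|x|) `^ (- p))%:E < +oo)%E.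
Proof.
have ax (x : R) : (0 < 1 + `|x|)%R by rewrite ltr_pwDl.
rewrite ge0_symfun_integralT.
- apply: lte_mul_pinfty => //.
  pose g (x : R) : \bar R := ((fun x : R => (x `^ (- p))%:E) \_ `[1%R, +oo[) x.
  have mp : measurable_fun setT (fun x : R => (x `^ (- p))%:E).
    by apply/measurable_EFinP; exact: measurable_powR.
  rewrite -set_itvcy.
  have <- : (\int[leb]_x g (x + 1)%R =
      \int[leb]_(x in `[0%R, +oo[) ((1 + `|x|) `^ (- p))%:E)%E.
    rewrite [RHS]integral_mkcond; apply: eq_integral => x _.
    rewrite /g !patchE !mem_setE !in_itv/= !andbT -lerBlDr subrr.
    by case: ifPn => // x0; rewrite ger0_norm// addrC.
  rewrite lebesgue_translation.
  + by rewrite /g -integral_mkcond integral_powR_itv1y ltry.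
  + exact: ((measurable_restrictT (fun x : measurableTypeR R => (x `^ (- p))%:E)
      (measurable_itv _)).1 (measurable_funTS mp)).
  + by move=> x; apply: erestrict_ge0 => y _; rewrite lee_fin powR_ge0.
- by move=> x; exact: powR_ge0.
- move=> x; apply: (@continuous_comp _ _ _ (fun x : R => 1 + `|x|)%R
    (fun y : R => y `^ (- p))%R).
    by apply: cvgD; [exact: cvg_cst|exact: norm_continuous].
  apply: differentiable_continuous; apply/derivable1_diffP.
  by apply: derivable_powR; rewrite in_itv/= andbT.
- by move=> x /=; rewrite normrN.
Qed.

Variable n : nat.
Hypothesis n0 : (0 < n)%N.
Local Notation vec := 'cV[R]_n.
Local Notation tup := (n.-tuple (measurableTypeR R)).
Local Notation vt := (@vec_of_tuple R n).
Local Notation Leb := (@vec_lebesgue R n).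
Variables (w : vec -> R) (C : R).
Hypothesis mw : measurable_fun setT (w \o vt).
Hypothesis w0 : forall x, (0 <= w x)%R.
Hypothesis w_le : forall (x : vec) k,
  ((1 + `|x k 0|) * w x <= C * \prod_i (1 + `|x i 0|) `^ (- p))%R.

(** A product over the coordinates integrates to a power of a one-dimensional integral, finite since
    [1 < p]. The factor [1 + |x_k|] in [w_le] lets this one function dominate both [w] and
    [x_k w]. *)
Let integrable_bound : Leb.-integrable setT
  (fun t => (C * \prod_i (1 + `|vt t i 0|) `^ (- p))%:E).
Proof.
suff : Leb.-integrable setT (fun t => (\prod_i (1 + `|vt t i 0|) `^ (- p))%:E).
  exact: (integrableZl measurableT C).
apply/integrableP; split.
  apply/measurable_EFinP; apply: measurable_prod => i _.
  apply: (@measurableT_comp _ _ _ _ _ _ (@powR R ^~ (- p))).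
    exact: measurable_powR.
  apply: measurable_funD => //; apply: measurableT_comp => //.
  exact: measurable_vt_coord.
rewrite (eq_integral (fun t : tup => (\prod_(i < n) (1 + `|tnth t i|) `^ (- p))%:E)).
  rewrite [X in (X < _)%E](@integral_power_prod _ (measurableTypeR R) R leb n
    (fun x => (1 + `|x|) `^ (- p))%R).
  - have : (\int[leb]_x ((1 + `|x|) `^ (- p))%:E)%E \is a fin_num.
      rewrite ge0_fin_numE; first exact: integral_power_decay_lty.
      by apply: integral_ge0 => x _; rewrite lee_fin powR_ge0.
    by move=> /fineK <-; rewrite -EFin_expe ltry.
  - apply: (@measurableT_comp _ _ _ _ _ _ (@powR R ^~ (- p))).
      exact: measurable_powR.
    by apply: measurable_funD => //; exact: measurableT_comp.
  - by move=> x; exact: powR_ge0.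
move=> t _; rewrite gee0_abs ?lee_fin ?prodr_ge0//.
by congr EFin; apply: eq_bigr => i _; rewrite mxE.
Qed.

Lemma integrable_decay : Leb.-integrable setT (fun t => (w (vt t))%:E).
Proof.
apply: (le_integrable measurableT _ _ integrable_bound); first exact/measurable_EFinP.
move=> t _; rewrite lee_fin; apply: le_trans (ler_norm _).
apply: le_trans (w_le (vt t) (Ordinal n0)).
by rewrite ger0_norm// ler_peMl// lerDl.
Qed.

Lemma integrable_coord_decay k :
  Leb.-integrable setT (fun t => (vt t k 0 * w (vt t))%:E).
Proof.
apply: (le_integrable measurableT _ _ integrable_bound).
  apply/measurable_EFinP; apply: measurable_funM => //.
  exact: measurable_vt_coord.
move=> t _; rewrite lee_fin; apply: le_trans (ler_norm _).
apply: le_trans (w_le (vt t) k).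
by rewrite normrM [X in (_ * X)%R]ger0_norm// ler_wpM2r// lerDr.
Qed.

End PowerDecay.

Section Weights.
Context {R : realType} {n : nat}.
Hypothesis n0 : (0 < n)%N.
Local Notation vec := 'cV[R]_n.
Local Notation vt := (@vec_of_tuple R n).

Lemma gauss_density_decay (x : vec) k : (1 + `|x k 0|) * gauss_density x <=
  (64 * normal_peak 1) ^+ n * \prod_i (1 + `|x i 0|) `^ (- 2).
Proof.
rewrite /gauss_density (bigD1 k)//= mulrA.
have pdf_le (y : R) : (1 + `|y|) * normal_pdf 0 1 y <=
    64 * normal_peak 1 * (1 + `|y|) `^ (- 2).
  rewrite normal_pdfE ?oner_neq0// powR_invn// (mulrC 64) -mulrA mulrCA.
  rewrite ler_wpM2l ?normal_peak_ge0// -ler_pdivrMr; last first.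
    by rewrite invr_gt0 exprn_gt0// ltr_pwDl.
  rewrite invrK /normal_fun subr0 expr1n.
  (* Three factors [1 + |y|] must be absorbed: one from the left-hand side and two for the power
     [- 2]. The cube of this bound is [64 * expR (3 y^2 / 8)], still beaten by
     [expR (- y^2 / 2)]. *)
  have y1 : 1 + `|y| <= 4 * expR (y ^+ 2 / 8).
    have := expR_ge1Dx (y ^+ 2 / 8); have := sqr_ge0 (`|y| - 1).
    rewrite -(real_normK (num_real y)); nra.
  have y3 : (1 + `|y|) ^+ 3 <= 64 * expR (y ^+ 2 / 8) ^+ 3.
    rewrite (le_trans (lerXn2r _ _ _ y1))// ?nnegrE ?addr_ge0 ?mulr_ge0 ?expR_ge0//.
    by rewrite exprMn; lra.
  have : expR (y ^+ 2 / 8) ^+ 3 * expR (- y ^+ 2 / 2) <= 1.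
    rewrite -expRM_natl -expRD -[leRHS]expR0 ler_expR.
    have := sqr_ge0 y; lra.
  have := expR_ge0 (- y ^+ 2 / 2).
  rewrite (_ : 1 *+ 2 = 2 :> R)//.
  move: (expR (- y ^+ 2 / 2)) (expR (y ^+ 2 / 8) ^+ 3) y3 => u v y3 u0 vu.
  rewrite (_ : _ * _ = (1 + `|y|) ^+ 3 * u); last by ring.
  apply: le_trans (ler_wpM2r u0 y3) _; rewrite -mulrA; lra.
have -> : (64 * normal_peak 1) ^+ n = \prod_(i < n) (64 * normal_peak 1) :> R.
  by rewrite prodr_const card_ord.
rewrite -big_split/= [leRHS](bigD1 k)//=.
apply: ler_pM; rewrite ?mulr_ge0 ?addr_ge0 ?normal_pdf_ge0//.
  by apply: prodr_ge0 => i _; exact: normal_pdf_ge0.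
apply: ler_prod => i _; rewrite normal_pdf_ge0/=.
apply: le_trans (pdf_le (x i 0)).
by rewrite ler_peMl ?normal_pdf_ge0// lerDl.
Qed.

Definition power_weight (c s : R) (x : vec) : R := (1 + c * inner x x) `^ (- s).

(** With [E] the square root of [(1 + c |x|^2) / kap], every [1 + |x_i|] is at most [E], and the
    weight is a constant times [E] to the power [- 2 s]. One factor [E] absorbs [1 + |x_k|]; the
    remaining power [- (2 s - 1)] is shared equally among the [n] coordinates. *)
Lemma power_weight_decay c s (x : vec) k : 0 < c -> 1 <= 2 * s ->
  (1 + `|x k 0|) * power_weight c s x <=
  (Num.min 1 c / 2) `^ (- s) *
  \prod_i (1 + `|x i 0|) `^ (- ((2 * s - 1) / n%:R)).
Proof.
(* Chosen so that [kap (1 + u)^2 <= 2 kap (1 + u^2) <= 1 + c u^2]. *)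
move=> c0 s2; set kap := Num.min 1 c / 2; set D := 1 + c * inner x x.
have s1 : 0 <= 2 * s - 1 by rewrite subr_ge0.
have [kap0 kap1 kapc] : [/\ 0 < kap, 2 * kap <= 1 & 2 * kap <= c].
  have -> : 2 * kap = Num.min 1 c by rewrite /kap mulrC divfK.
  rewrite !ge_min !lexx orbT; split=> //.
  by rewrite divr_gt0// lt_min ltr01.
have D_ge i : kap * (1 + `|x i 0|) ^+ 2 <= D.
  have : x i 0 * x i 0 <= inner x x.
    rewrite /inner (bigD1 i)//= lerDl; apply: sumr_ge0 => j _.
    by rewrite -expr2 sqr_ge0.
  have := sqr_ge0 (`|x i 0| - 1); rewrite -expr2 -(real_normK (num_real (x i 0))).
  rewrite /D; move: `|x i 0| (inner x x) => u r; nra.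
have D0 : 0 < D by rewrite ltr_pwDl// mulr_ge0 ?inner_ge0// ltW.
pose E := Num.sqrt (D / kap).
have E2 : E ^+ 2 = D / kap by rewrite sqr_sqrtr// divr_ge0 ?ltW.
have E0 : 0 < E by rewrite sqrtr_gt0 divr_gt0.
have E_ge i : 1 + `|x i 0| <= E.
  rewrite -(@ler_pXn2r _ 2) ?nnegrE ?addr_ge0 ?(ltW E0)//.
  by rewrite E2 ler_pdivlMr// mulrC.
have -> : power_weight c s x = kap `^ (- s) * E `^ (- (2 * s)).
  rewrite /power_weight -/D -[in LHS](divfK (lt0r_neq0 kap0) D) -E2 mulrC.
  rewrite powRM ?exprn_ge0 ?(ltW E0) ?(ltW kap0)//; congr (_ * _).
  by rewrite -powR_mulrn ?(ltW E0)// -powRrM mulrN.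
rewrite mulrCA ler_wpM2l ?powR_ge0//.
apply: (@le_trans _ _ (E `^ (- (2 * s - 1)))).
  have -> : - (2 * s - 1) = 1 + - (2 * s) :> R by lra.
  rewrite powRD; last by rewrite (gt_eqF E0) implybT.
  rewrite powRr1 ?(ltW E0)//.
  by rewrite ler_wpM2r ?powR_ge0.
have -> : E `^ (- (2 * s - 1)) = \prod_(i < n) E `^ (- ((2 * s - 1) / n%:R)).
  rewrite prodr_const card_ord -powR_mulrn ?powR_ge0// -powRrM mulNr divfK//.
  by rewrite pnatr_eq0 -lt0n.
apply: ler_prod => i _; rewrite powR_ge0/= !powRN lef_pV2 ?posrE ?powR_gt0 ?ltr_pwDl//.
by apply: ge0_ler_powR; rewrite ?nnegrE ?addr_ge0 ?(ltW E0) ?divr_ge0 ?ler0n.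
Qed.

Lemma measurable_power_weight c s : measurable_fun setT (power_weight c s \o vt).
Proof.
apply: (@measurableT_comp _ _ _ _ _ _ (@powR R ^~ (- s))).
  exact: measurable_powR.
apply: measurable_funD => //; apply: measurable_funM => //.
by apply: measurable_sum => i; apply: measurable_funM; exact: measurable_vt_coord.
Qed.

End Weights.

(** * Base functions and the mean width *)

Section Base.
Context {R : realType} {n : nat} (alpha : R).
Local Notation vec := 'cV[R]_n.
Hypothesis alpha0 : alpha <= 0.
Implicit Types (h : vec -> R) (p phi : vec -> \bar R).

Lemma base_gtNy h x : (-oo < base alpha h x)%E.
Proof. by rewrite /base; case: ifP => // _; case: ifP => // _; rewrite ltNyr. Qed.

(** For [alpha < 0] the hypothesis rearranges to [1 - alpha * r >= h x ^ alpha], a positive number.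
    This is the range of [r] on which [unbase] can be inverted. *)
Lemma base_le_fin h x r : 0 <= h x -> (base alpha h x <= r%:E)%E ->
  0 < 1 - alpha * r.
Proof.
rewrite /base => hx; case: eqP => // /eqP h0.
have {}h0 : 0 < h x by rewrite lt_neqAle eq_sym h0.
case: eqP => [-> _|/eqP al0]; first by rewrite mul0r subr0.
have al_lt0 : alpha < 0 by rewrite lt_neqAle al0.
rewrite lee_fin ler_ndivrMr// mulrC => le1.
by have := powR_gt0 alpha h0; lra.
Qed.

Lemma base_unbase_fin phi x r : phi x = r%:E ->
  (alpha != 0 -> 0 < 1 - alpha * r) -> base alpha (unbase alpha phi) x = r%:E.
Proof.
rewrite /base /unbase => ->; have [al0 _|al0 /(_ isT) r1] := eqVneq alpha 0.
  by rewrite gt_eqF ?expR_gt0// expRK opprK.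
rewrite gt_eqF ?powR_gt0// -powRrM mulVf// powRr1 ?(ltW r1)//.
by rewrite opprB addrCA subrr addr0 mulrAC divff ?mul1r.
Qed.

Lemma base_unbase_pinfty phi x : phi x = +oo%E ->
  base alpha (unbase alpha phi) x = +oo%E.
Proof. by rewrite /base /unbase => ->; rewrite eqxx. Qed.

(* When [1 - alpha * phi x <= 0], [unbase] takes a junk value: [0] or [1]. *)
Lemma le_base_unbase phi x : (-oo < phi x)%E ->
  (phi x <= base alpha (unbase alpha phi) x)%E.
Proof.
case E : (phi x) => [r| |]// _; last by rewrite base_unbase_pinfty.
have [r1|r1] := ltP 0 (1 - alpha * r); first by rewrite (base_unbase_fin E).
have [al0|al0] := eqVneq alpha 0.
  by move: r1; rewrite al0 mul0r subr0 ler10.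
have al_lt0 : alpha < 0 by rewrite lt_neqAle al0.
rewrite /base /unbase E (negPf al0).
move: r1; rewrite le_eqVlt => /predU1P[->|r1].
  by rewrite powR0 ?invr_eq0// eqxx leey.
rewrite lt0_powR1// oner_eq0 powR1 subrr mul0r lee_fin.
rewrite leNgt; apply/negP => r0.
have : alpha * r <= 0 by rewrite mulr_le0_ge0// ltW.
lra.
Qed.

Lemma base_unbase_linearization N h p : (forall x, 0 <= h x) ->
  inner_linearizations N (base alpha h) p -> base alpha (unbase alpha p) = p.
Proof.
move=> h0 [[M [xs [ys [M0 ysP ->]]]] _].
case: M M0 xs ys ysP => // M _ xs ys ysP; apply/funext => x.
(* Slope 0 says that the value at [x] is at least the smallest [ys i], to which [base_le_fin]
   applies. *)
have := inner_linearization_ge xs ys 0 x.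
case E : (inner_linearization xs ys x) => [r| |]//; last first.
  by rewrite base_unbase_pinfty.
rewrite lee_fin => r_ge; apply: (base_unbase_fin E) => al0.
have al_lt0 : alpha < 0 by rewrite lt_neqAle al0.
have [i max_i] := max_aff_attained xs ys 0.
have := base_le_fin (h0 _) (ysP i).
move: r_ge; rewrite max_i /aff !(innerC 0) !inner0r !sub0r opprK => yr.
have : alpha * r <= alpha * ys i by rewrite ler_wnM2l// ltW.
lra.
Qed.

End Base.

Section MeanWidth.
Context {R : realType} {n : nat} (alpha : R).
Local Notation vec := 'cV[R]_n.
Local Notation tup := (n.-tuple (measurableTypeR R)).
Local Notation vt := (@vec_of_tuple R n).
Local Notation Leb := (@vec_lebesgue R n).
Hypothesis n0 : (0 < n)%N.
Hypothesis alpha0 : alpha <= 0.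
Hypothesis alphan : (1 < n)%N -> - (2 / (n - 1)%:R) < alpha.

(** For [alpha = 0] the Gaussian measure is absorbed into a density, so that both cases become
    integrals against Lebesgue measure with a radial weight. *)
Definition width_weight : vec -> R :=
  if alpha == 0 then gauss_density
  else power_weight (- alpha / 2) (- ((1 - alpha) / alpha)).

Definition width_factor : R := if alpha == 0 then 2 / n%:R else 1.

Lemma width_factor_gt0 : 0 < width_factor.
Proof.
by rewrite /width_factor; case: ifP => // _; rewrite divr_gt0// ltr0n.
Qed.

Lemma width_weight_ge0 x : 0 <= width_weight x.
Proof.
rewrite /width_weight; case: ifP => _; first exact: gauss_density_ge0.
exact: powR_ge0.
Qed.

Lemma measurable_width_weight : measurable_fun setT (width_weight \o vt).
Proof.
rewrite /width_weight; case: ifP => _; first exact: measurable_gauss_density.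
exact: measurable_power_weight.
Qed.

Lemma width_weight_radial Q x : orthogonal_group Q ->
  width_weight (Q *m x) = width_weight x.
Proof.
move=> oQ; rewrite /width_weight; case: ifP => _; first exact: gauss_density_radial.
by rewrite /power_weight inner_orthogonal.
Qed.

Lemma width_weight_decay : exists p C, 1 < p /\ forall (x : vec) k,
  (1 + `|x k 0|) * width_weight x <= C * \prod_i (1 + `|x i 0|) `^ (- p).
Proof.
rewrite /width_weight; have [_|al0] := eqVneq alpha 0.
  by exists 2, ((64 * normal_peak 1) ^+ n); split; [lra|exact: gauss_density_decay].
have al_lt0 : alpha < 0 by rewrite lt_neqAle al0.
set s := - ((1 - alpha) / alpha); set c := - alpha / 2.
have c0 : 0 < c by rewrite divr_gt0// oppr_gt0.
(* The decay exponent is [(1 + 2 u) / n]; it exceeds 1 exactly when [u > (n - 1) / 2], which for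
   [n > 1] is [alphan]. *)
pose u := - alpha^-1.
have u0 : 0 < u by rewrite oppr_gt0 invr_lt0.
have ual : u * alpha = -1 by rewrite mulNr mulVf.
have sE : 2 * s - 1 = 1 + 2 * u.
  by rewrite /s /u mulrBl divff// mul1r; lra.
exists ((2 * s - 1) / n%:R), ((Num.min 1 c / 2) `^ (- s)); split; last first.
  by move=> x k; apply: power_weight_decay => //; lra.
rewrite sE ltr_pdivlMr ?ltr0n// mul1r.
have [n1|] := leqP n 1.
  have -> : n = 1%N by apply/eqP; rewrite eqn_leq n1.
  by lra.
move=> n1; have := alphan n1; rewrite natrB; last exact: ltnW.
have n10 : 0 < n%:R - 1 :> R by rewrite subr_gt0 ltr1n.
rewrite ltrNl ltr_pdivlMr//.
nra.
Qed.

Lemma integrable_width_weight :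
  Leb.-integrable setT (fun t => (width_weight (vt t))%:E).
Proof.
have [p [C [p1 decay]]] := width_weight_decay.
exact: (integrable_decay p1 n0 measurable_width_weight width_weight_ge0 decay).
Qed.

Lemma integrable_coord_width_weight k :
  Leb.-integrable setT (fun t => (vt t k 0 * width_weight (vt t))%:E).
Proof.
have [p [C [p1 decay]]] := width_weight_decay.
exact: (integrable_coord_decay p1 measurable_width_weight width_weight_ge0 decay).
Qed.

Lemma mean_width_max_aff (q : vec -> R) m (zs : 'I_m.+1 -> vec) ts :
  (forall x, legendre (base alpha q) x = (max_aff zs ts x)%:E) ->
  mean_width alpha q =
  (width_factor * \int[Leb]_t (max_aff zs ts (vt t) * width_weight (vt t)))%:E.
Proof.
move=> qE; have int_max := integrable_max_aff_weight integrable_width_weight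
  integrable_coord_width_weight zs ts.
rewrite EFinM /Rintegral fineK; last exact: integrable_fin_num.
rewrite /mean_width /support_fun /width_factor /width_weight.
case: ifPn => [al0|al0]; last first.
  rewrite mul1e; apply: eq_integral => t _; rewrite qE -EFinM; congr (_ * _)%:E.
  rewrite /power_weight opprK; congr (_ `^ _).
  by rewrite /enorm sqr_sqrtr ?inner_ge0// mulNr mulNr mulrAC.
congr (_ * _)%E; rewrite integral_vec_gauss_signed; last first.
  rewrite (_ : (fun t => _) = EFin \o (max_aff zs ts \o vt)).
    by apply/measurable_EFinP; exact: measurable_max_aff.
  by apply/funext => t; rewrite qE.
by apply: eq_integral => t _; rewrite qE -EFinM gauss_density_vt.
Qed.

End MeanWidth.

(** * Comparison of the two suprema *)

Theorem theorem5p2 (R : realType) (n N : nat) (alpha : R)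
    (eta : probability (g_sigma_algebraType (@open 'M[R]_n)) R)
    (f : 'cV[R]_n -> R) (psi_sym : 'cV[R]_n -> \bar R) :
  (1 <= n)%N -> (n + 2 <= N)%N ->
  ((1 < n)%N -> - (2 / (n - 1)%:R) < alpha) -> alpha <= 0 ->
  is_haar eta ->
  C_alpha alpha f ->
  is_hypo_sym eta (base alpha f) psi_sym ->
  (G_alpha alpha N (unbase alpha psi_sym) <= G_alpha alpha N f)%E.
Proof.
move=> n0 _ alphan alpha0 [etaO _] [[f0 _] _ [z fz] _] [[sym_gt _ _ _ _] _ symE].
have unbase0 x : 0 <= unbase alpha psi_sym x.
  rewrite /unbase; case: (psi_sym x) => // r.
  by case: ifP => _; [exact: expR_ge0|exact: powR_ge0].
apply: ge_ereal_sup => _ [_ [p pIL <-] <-].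
have [m [xs [ys [mN ys_ge pE]]]] := inner_linearizations_support pIL.
rewrite (@mean_width_max_aff _ _ alpha n0 alpha0 alphan _ _ xs ys); last first.
  by move=> x; rewrite (base_unbase_linearization alpha0 unbase0 pIL).
have k0 := width_factor_gt0 alpha n0.
set W := \int[_]_t _; set k := width_factor _ in k0 *.
(* [width_averaging] works at levels strictly below [W]; the slack is divided by [k] because [k]
   multiplies the integral. *)
apply/lee_subgt0Pr => e e0.
have WS : W - e / k < W by rewrite ltrBlDr ltrDl divr_gt0.
(* The data of [p] lie above [base alpha (unbase alpha psi_sym)]. That function need not equal
   [psi_sym] where [unbase] is not invertible, but it is never smaller. *)
have sym_le i : (psi_sym (xs i) <= (ys i)%:E)%E.
  exact: le_trans (le_base_unbase alpha0 (sym_gt _)) (ys_ge i).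
have base_fin : (exists z, base alpha f z < +oo)%E.
  by exists z; rewrite /base (negPf fz); case: ifP => _; rewrite ltry.
have [zs [ts [ts_ge Wlt]]] := width_averaging
  (width_weight_ge0 alpha)
  (@width_weight_radial R n alpha)
  (integrable_width_weight n0 alpha0 alphan)
  (integrable_coord_width_weight n0 alpha0 alphan)
  etaO symE base_fin (base_gtNy alpha f) sym_le WS.
have qIL := inner_linearizations_mem mN ts_ge.
apply: le_trans (ereal_sup_ubound _); last first.
  exists (unbase alpha (inner_linearization zs ts)) => //.
  by exists (inner_linearization zs ts).
rewrite (@mean_width_max_aff _ _ alpha n0 alpha0 alphan _ _ zs ts); last first.
  move=> x; rewrite (base_unbase_linearization alpha0 f0 qIL).
  exact: legendre_inner_linearization.
rewrite -EFinB lee_fin -/k.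
have -> : k * W - e = k * (W - e / k)
  by rewrite mulrBr mulrCA divff ?mulr1// gt_eqF.
by rewrite ler_wpM2l// ltW.
Qed.
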